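(* Let $M\ge0$ be real. Assume that the function $f=f(x,t)$, $x\in\mathbb R$, $t\ge0$, is continuous along with all its second order derivatives, and that for every fixed $t$ it has compact support, $\operatorname{supp} f(\cdot,t)\subset\mathbb R$. Then the function $$u(x,t)=\int_0^t db\int_{x-(e^{-b}-e^{-t})}^{x+e^{-b}-e^{-t}}dy\, f(y,b)\,(4e^{-b-t})^{iM}\big((e^{-t}+e^{-b})^2-(x-y)^2\big)^{-\frac12-iM}F\Big(\tfrac12+iM,\tfrac12+iM;1;\frac{(e^{-b}-e^{-t})^2-(x-y)^2}{(e^{-b}+e^{-t})^2-(x-y)^2}\Big)$$ is a $C^2$-solution of the Cauchy problem $$u_{tt}-e^{-2t}u_{xx}+M^2u=f(x,t),\quad t>0,\ x\in\mathbb R,\qquad u(x,0)=u_t(x,0)=0 .$$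
   Context: $F(a,b;c;\zeta)$ denotes the Gauss hypergeometric function. *)

(* Defs.v *)
From Stdlib Require Import Reals Factorial.
From Coquelicot Require Import Coquelicot.

Open Scope R_scope.

Definition Cexp (z : C) : C :=
  (exp (Re z) * cos (Im z), exp (Re z) * sin (Im z)).

(* [r ^ w] for a positive real base [r], with the real logarithm of [r].
   [ln] is the junk value [0] for [r <= 0]. *)
Definition cpower (r : R) (w : C) : C := Cexp (w * RtoC (ln r))%C.

(* Rising factorial [a (a + 1) ... (a + n - 1)]. *)
Fixpoint pochhammer (a : C) (n : nat) : C :=
  match n with
  | O => RtoC 1
  | S k => (pochhammer a k * (a + RtoC (INR k)))%C
  end.

Definition hyp_term (a b c z : C) (n : nat) : C :=
  (pochhammer a n * pochhammer b n
     / (pochhammer c n * RtoC (INR (fact n))) * z ^ n)%C.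

(* Coquelicot's total sum [Series] is real-valued, so real and imaginary parts
   are summed separately.  This is the Gauss function in the unit disc
   [Cmod z < 1] only, without analytic continuation. *)
Definition hypergeom (a b c z : C) : C :=
  (Series (fun n => Re (hyp_term a b c z n)),
   Series (fun n => Im (hyp_term a b c z n))).

(* [C] is regarded throughout as a normed space over [R]. *)

(* This is [is_derive g t l] with [locally t] restricted to [0 <= s]: the usual
   derivative for [0 < t], the right derivative for [t = 0]. *)
Definition is_derive_time (g : R -> C) (t : R) (l : C) : Prop :=
  filterdiff (V := C_R_NormedModule) g
    (within (fun s => 0 <= s) (locally t))
    (fun s => scal (V := C_R_NormedModule) s l).

(* Relative continuity in [(x, t)] jointly; values at [t < 0] are irrelevant. *)
Definition continuous_half (g : R -> R -> C) : Prop :=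
  continuous_on (U := C_R_NormedModule)
    (fun p : R * R => 0 <= snd p) (fun p => g (fst p) (snd p)).

Definition is_partial_x (g gx : R -> R -> C) : Prop :=
  forall x t, 0 <= t ->
    is_derive (V := C_R_NormedModule) (fun y => g y t) x (gx x t).

Definition is_partial_t (g gt : R -> R -> C) : Prop :=
  forall x t, 0 <= t -> is_derive_time (g x) t (gt x t).

(* [gxt] is [(g_x)_t] and [gtx] is [(g_t)_x]. *)
Record partials2 (g gx gt gxx gxt gtx gtt : R -> R -> C) : Prop := {
  partials2_x : is_partial_x g gx;
  partials2_t : is_partial_t g gt;
  partials2_xx : is_partial_x gx gxx;
  partials2_xt : is_partial_t gx gxt;
  partials2_tx : is_partial_x gt gtx;
  partials2_tt : is_partial_t gt gtt }.

Definition continuous_with_second_derivatives (g : R -> R -> C) : Prop :=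
  exists gx gt gxx gxt gtx gtt : R -> R -> C,
    partials2 g gx gt gxx gxt gtx gtt /\
    continuous_half g /\
    continuous_half gxx /\ continuous_half gxt /\
    continuous_half gtx /\ continuous_half gtt.

(* [g] is of class C^2 up to the boundary [t = 0], with the given partials. *)
Definition is_C2_with (g gx gt gxx gxt gtx gtt : R -> R -> C) : Prop :=
  partials2 g gx gt gxx gxt gtx gtt /\
  continuous_half g /\ continuous_half gx /\ continuous_half gt /\
  continuous_half gxx /\ continuous_half gxt /\
  continuous_half gtx /\ continuous_half gtt.

(* [adherence] is the topological closure. *)
Definition support (g : R -> C) : R -> Prop :=
  adherence (fun x => g x <> RtoC 0).

Definition is_C2_solution (M : R) (f u : R -> R -> C) : Prop :=
  exists ux ut uxx uxt utx utt : R -> R -> C,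
    is_C2_with u ux ut uxx uxt utx utt /\
    (forall x t, 0 < t ->
       (utt x t - RtoC (exp (- 2 * t)) * uxx x t + RtoC (M ^ 2) * u x t)%C
         = f x t) /\
    (forall x, u x 0 = RtoC 0 /\ ut x 0 = RtoC 0).

Definition iC (M : R) : C := (Ci * RtoC M)%C.

Definition half : C := RtoC (1 / 2).

Definition kernel (M x t y b : R) : C :=
  let num := (exp (- b) - exp (- t)) ^ 2 - (x - y) ^ 2 in
  let den := (exp (- b) + exp (- t)) ^ 2 - (x - y) ^ 2 in
  (cpower (4 * exp (- b - t)) (iC M)
   * cpower den (- half - iC M)
   * hypergeom (half + iC M) (half + iC M) (RtoC 1) (RtoC (num / den)))%C.

Definition source_solution (M : R) (f : R -> R -> C) (x t : R) : C :=
  RInt (V := C_R_CompleteNormedModule)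
    (fun b =>
       RInt (V := C_R_CompleteNormedModule)
         (fun y => (f y b * kernel M x t y b)%C)
         (x - (exp (- b) - exp (- t))) (x + exp (- b) - exp (- t)))
    0 t.

(* Main.v *)
(** With [phi = e^{-b} - e^{-t}], [tau = t - b] and [y = x + phi s], the kernel
    satisfies [phi * kernel = sinh (tau/2) * P (w)], where
    [w = (1 - s^2) sinh^2 (tau/2)] and [P (w) = (1 + w)^(-1/2 - i M) F (w / (1 + w))].
    The hypergeometric equation turns into the real equation
    [w (1 + w) P'' + (1 + 2 w) P' + (1/4 + M^2) P = 0], so the real and the
    imaginary part of [P] can be treated separately.  On the fixed domain
    [-1 <= s <= 1] one may differentiate under the integral: the boundary term at
    [b = t] vanishes in [u_t] because [phi = 0] there, and equals [P 0 * f = f] in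
    [u_tt].  For fixed [b < t] the remaining integrand of
    [u_tt - e^{-2t} u_xx + M^2 u] is an exact derivative in [s] whose primitive
    vanishes at [s = 1] and [s = -1]. *)

Require Import Defs.
From Stdlib Require Import Reals Factorial Lra Lia Psatz Classical ClassicalEpsilon.
From Coquelicot Require Import Coquelicot.
Open Scope R_scope.

(** * Continuity and differentiation of parametric integrals *)

(** The kernel formula is meaningful only inside the light cone and the source is given only for
    [t >= 0], while differentiation under the integral asks for hypotheses on full neighbourhoods.
    Both are therefore replaced by globally defined objects. The Jacobian [phi] of the rescaling is
    absorbed into the kernel, and [phi * kernel] extends continuously to all real [t], [b], [s] once
    [1 - s^2] is truncated at [0]. After the rescaling [t] enters the source only through its
    spatial argument, so every derivative falls on the kernel or on the source in [x]; reflection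
    [t -> |t|] preserves continuity and [x]-derivatives and is thus a sufficient extension. The
    complex product of source and kernel becomes four real Duhamel integrals, one for each part of
    [f] and part of [P]; the wave equation is linear, so one real result serves all four. *)

Definition cont {U : UniformSpace} (F : U -> R) : Prop :=
  forall p, continuous (U := R_UniformSpace) F p.

Definition cont2 (g : R -> R -> R) : Prop :=
  cont (fun p : R * R => g (fst p) (snd p)).

Definition cont3 (g : R -> R -> R -> R) : Prop :=
  cont (fun p : R * R * R => g (fst (fst p)) (snd (fst p)) (snd p)).

Lemma cont_ext {U : UniformSpace} (F G : U -> R) :
  (forall p, F p = G p) -> cont F -> cont G.
Proof.
  intros E H p. apply continuous_ext with F; auto.
Qed.

Lemma cont_const {U : UniformSpace} (c : R) : cont (fun _ : U => c).
Proof. intros p; apply continuous_const. Qed.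

Lemma cont_plus {U : UniformSpace} (F G : U -> R) :
  cont F -> cont G -> cont (fun p => F p + G p).
Proof. intros HF HG p; apply (continuous_plus (V := R_NormedModule) F G); auto. Qed.

Lemma cont_opp {U : UniformSpace} (F : U -> R) :
  cont F -> cont (fun p => - F p).
Proof. intros HF p; apply (continuous_opp (V := R_NormedModule) F); auto. Qed.

Lemma cont_minus {U : UniformSpace} (F G : U -> R) :
  cont F -> cont G -> cont (fun p => F p - G p).
Proof. intros HF HG p; apply (continuous_minus (V := R_NormedModule) F G); auto. Qed.

Lemma cont_mult {U : UniformSpace} (F G : U -> R) :
  cont F -> cont G -> cont (fun p => F p * G p).
Proof. intros HF HG p; apply (continuous_mult (K := R_AbsRing) F G); auto. Qed.

Lemma cont_pow {U : UniformSpace} (F : U -> R) n :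
  cont F -> cont (fun p => F p ^ n).
Proof.
  intros HF; induction n as [|n IH]; simpl; [apply cont_const|].
  apply cont_mult; auto.
Qed.

Lemma cont_comp {U : UniformSpace} (h : R -> R) (F : U -> R) :
  (forall p, continuous h (F p)) -> cont F -> cont (fun p => h (F p)).
Proof. intros Hh HF p; apply (continuous_comp F h); auto. Qed.

Lemma cont_exp {U : UniformSpace} (F : U -> R) :
  cont F -> cont (fun p => exp (F p)).
Proof. apply cont_comp; intros p; apply continuous_exp. Qed.

Lemma cont_fst {U V : UniformSpace} (F : U -> R) :
  cont F -> cont (fun p : U * V => F (fst p)).
Proof. intros HF [p q]; apply (continuous_comp fst F); [apply continuous_fst | auto]. Qed.

Lemma cont_snd {U V : UniformSpace} (F : V -> R) :
  cont F -> cont (fun p : U * V => F (snd p)).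
Proof. intros HF [p q]; apply (continuous_comp snd F); [apply continuous_snd | auto]. Qed.

Lemma cont_id : cont (fun x : R => x).
Proof. intros p; apply continuous_id. Qed.

Lemma cont_comp2 {U : UniformSpace} (g : R -> R -> R) (F G : U -> R) :
  cont2 g -> cont F -> cont G -> cont (fun p => g (F p) (G p)).
Proof.
  intros Hg HF HG p.
  apply (continuous_comp_2 (V := R_UniformSpace) (W := R_UniformSpace) F G g); auto.
Qed.

Lemma cont_pair {U V : UniformSpace} {W : UniformSpace} (F : U -> V) (G : U -> W)
    (h : V * W -> R) :
  (forall p, continuous F p) -> (forall p, continuous G p) -> cont h ->
  cont (fun p => h (F p, G p)).
Proof.
  intros HF HG Hh p.
  apply (continuous_comp_2 F G (fun v w => h (v, w))); auto.
  apply continuous_ext with h; [intros [v w]; reflexivity | apply Hh].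
Qed.

Lemma continuous_pair {U V W : UniformSpace} (F : U -> V) (G : U -> W) p :
  continuous F p -> continuous G p -> continuous (fun q => (F q, G q)) p.
Proof.
  intros HF HG.
  apply (continuous_comp_2 F G (fun v w => (v, w))); auto.
  apply continuous_ext with (fun q => q); [intros [v w]; reflexivity | apply continuous_id].
Qed.

Lemma cont_comp3 {U : UniformSpace} (g : R -> R -> R -> R) (F G H : U -> R) :
  cont3 g -> cont F -> cont G -> cont H -> cont (fun p => g (F p) (G p) (H p)).
Proof.
  intros Hg HF HG HH.
  refine (cont_pair (V := prod_UniformSpace R_UniformSpace R_UniformSpace)
    (W := R_UniformSpace) (fun p => (F p, G p)) H
    (fun q => g (fst (fst q)) (snd (fst q)) (snd q)) _ HH Hg).
  intros p; apply continuous_pair; auto.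
Qed.

(** Besides the patterns with a binder there are partially applied ones such as [Rmult ?a], for
    goals that appear in eta-reduced form. *)
Ltac cont_step :=
  match goal with
  | H : cont ?F |- cont ?F => exact H
  | |- cont (fun p => p) => exact cont_id
  | |- cont (fun _ => ?c) => exact (cont_const c)
  | |- cont (fun p => _ + _) => apply cont_plus
  | |- cont (fun p => _ - _) => apply cont_minus
  | |- cont (fun p => - _) => apply cont_opp
  | |- cont (fun p => _ * _) => apply cont_mult
  | |- cont (fun p => _ ^ ?n) => apply cont_pow
  | |- cont (fun p => exp _) => apply cont_exp
  | H : cont2 ?g |- cont (fun p => ?g _ _) => apply (cont_comp2 g); [exact H | |]
  | H : cont3 ?g |- cont (fun p => ?g _ _ _) => apply (cont_comp3 g); [exact H | | |]
  | |- cont (Rmult ?a) => refine (cont_mult (fun _ => a) (fun x => x) _ _)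
  | |- cont (Rplus ?a) => refine (cont_plus (fun _ => a) (fun x => x) _ _)
  | |- cont (Rminus ?a) => refine (cont_minus (fun _ => a) (fun x => x) _ _)
  | H : cont2 ?g |- cont (?g ?a) =>
      refine (cont_comp2 g (fun _ => a) (fun x => x) H _ _)
  | H : cont3 ?g |- cont (?g ?a ?b) =>
      refine (cont_comp3 g (fun _ => a) (fun _ => b) (fun x => x) H _ _ _)
  | |- cont (fun p => fst p) => refine (cont_fst (fun x => x) _)
  | |- cont (@fst _ _) => refine (cont_fst (fun x => x) _)
  | |- cont (@snd _ _) => refine (cont_snd (fun x => x) _)
  | |- cont (fun p => snd p) => refine (cont_snd (fun x => x) _)
  | |- cont (fun p => fst (fst p)) => refine (cont_fst (fun x => fst x) _)
  | |- cont (fun p => snd (fst p)) => refine (cont_fst (fun x => snd x) _)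
  | |- cont (fun p => fst (fst (fst p))) => refine (cont_fst (fun x => fst (fst x)) _)
  | |- cont (fun p => snd (fst (fst p))) => refine (cont_fst (fun x => snd (fst x)) _)
  end.

Ltac cont_tac := cbn [fst snd]; repeat cont_step.

Lemma ex_RInt_cont (h : R -> R) (a b : R) : cont h -> ex_RInt h a b.
Proof. intros H; apply (ex_RInt_continuous (V := R_CompleteNormedModule)); intros; apply H. Qed.

(** Tube lemma: compactness of [[a, b]] makes the continuity at [p] uniform in [s]. *)
Lemma cont_uniform {U : UniformSpace} (F : U -> R -> R) (a b : R) (p : U) (eps : posreal) :
  cont (fun q : U * R => F (fst q) (snd q)) ->
  locally p (fun q => forall s, a <= s <= b -> Rabs (F q s - F p s) < eps).
Proof.
  intros HF.
  assert (H : forall s : R, exists d : posreal, forall q r, ball p d q -> Rabs (r - s) < d ->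
     Rabs (F q r - F p s) < eps / 2).
  { intros s.
    destruct (HF (p, s) (fun y => Rabs (y - F p s) < eps / 2)) as [d Hd].
    - exists (mkposreal (eps / 2) (is_pos_div_2 eps)). intros y Hy; exact Hy.
    - exists d. intros q r Hq Hr. apply (Hd (q, r)). split; [exact Hq | exact Hr]. }
  (* Compactness takes the radius as a function of the point, so choice is applied to [H]. *)
  set (d := fun s => proj1_sig (constructive_indefinite_description _ (H s))).
  assert (Hd : forall s q r, ball p (d s) q -> Rabs (r - s) < d s ->
     Rabs (F q r - F p s) < eps / 2)
    by (intros s; exact (proj2_sig (constructive_indefinite_description _ (H s)))).
  destruct (compactness_value_1d a b d) as [d0 Hd0].
  exists d0. intros q Hq s Hs.
  (* The centre [r] of the covering interval is available only under a double negation. Both [F q s]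
     and [F p s] are compared with [F p r], hence [eps / 2]. *)
  apply NNPP. intros Hn. apply (Hd0 s Hs). intros (r & Hr & Hsr & Hle). apply Hn.
  assert (H1 : Rabs (F q s - F p r) < eps / 2).
  { apply Hd; auto. apply ball_le with d0; auto. }
  assert (H2 : Rabs (F p s - F p r) < eps / 2).
  { apply Hd; auto. apply ball_center. }
  apply Rabs_def2 in H1. apply Rabs_def2 in H2. apply Rabs_def1; lra.
Qed.

Lemma cont_section {U : UniformSpace} (F : U -> R -> R) (p : U) :
  cont (fun q : U * R => F (fst q) (snd q)) -> cont (F p).
Proof.
  intros HF.
  refine (cont_pair (fun _ : R => p) (fun s => s) (fun q => F (fst q) (snd q)) _ _ HF);
  intros; [apply continuous_const | apply continuous_id].
Qed.

Lemma cont_RInt {U : UniformSpace} (F : U -> R -> R) (a b : R) : a <= b ->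
  cont (fun q : U * R => F (fst q) (snd q)) ->
  cont (fun p => RInt (V := R_CompleteNormedModule) (F p) a b).
Proof.
  intros Hab HF p P [eps HP].
  (* The [+ 1] keeps the denominator positive when [a = b] and makes the final bound strict. *)
  assert (Hpos : 0 < eps / (b - a + 1)).
  { apply Rdiv_lt_0_compat; [apply cond_pos | lra]. }
  pose proof (cont_uniform F a b p (mkposreal _ Hpos) HF) as HL.
  apply (filter_imp _ _ (fun q => fun Hq => HP _ Hq)).
  refine (filter_imp _ _ _ HL). intros q Hq. simpl in Hq.
  change (Rabs (RInt (F q) a b - RInt (F p) a b) < eps).
  assert (Eq := ex_RInt_cont _ a b (cont_section F q HF)).
  assert (Ep := ex_RInt_cont _ a b (cont_section F p HF)).
  change (RInt (F q) a b - RInt (F p) a b) with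
    (minus (RInt (V := R_CompleteNormedModule) (F q) a b)
      (RInt (V := R_CompleteNormedModule) (F p) a b)).
  rewrite <- RInt_minus; auto.
  eapply Rle_lt_trans; [apply abs_RInt_le_const with (M := eps / (b - a + 1)) |].
  - exact Hab.
  - apply (ex_RInt_minus (V := R_NormedModule)); auto.
  - intros s Hs. apply Rlt_le, Hq, Hs.
  - assert (He := cond_pos eps).
    apply Rmult_lt_reg_r with (b - a + 1); [lra|]. field_simplify; [|lra]. nra.
Qed.

Lemma cont2_continuity_2d_pt (g : R -> R -> R) x y : cont2 g -> continuity_2d_pt g x y.
Proof. intros H; apply continuity_2d_pt_filterlim; apply (H (x, y)). Qed.

Lemma is_derive_RInt_cont (F F' : R -> R -> R) (a b x : R) :
  (forall y s, is_derive (fun z => F z s) y (F' y s)) ->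
  cont2 F -> cont2 F' ->
  is_derive (fun y => RInt (F y) a b) x (RInt (F' x) a b).
Proof.
  intros HD HF HF'.
  evar_last.
  - apply (is_derive_RInt_param F a b x).
    + apply filter_forall. intros y s _. eexists; apply HD.
    + intros s _. apply continuity_2d_pt_ext with F'.
      * intros u v. symmetry. apply is_derive_unique, HD.
      * apply cont2_continuity_2d_pt, HF'.
    + apply filter_forall. intros y. apply ex_RInt_cont, (cont_section F y HF).
  - apply RInt_ext. intros s _. apply is_derive_unique, HD.
Qed.

(** The term [F t t] is the origin of every boundary contribution at [b = t]. *)
Lemma is_derive_RInt_upper (F F' : R -> R -> R) (t : R) :
  (forall y s, is_derive (fun z => F z s) y (F' y s)) ->
  cont2 F -> cont2 F' ->
  is_derive (fun y => RInt (F y) 0 y) t (F t t + RInt (F' t) 0 t).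
Proof.
  intros HD HF HF'.
  assert (HI : forall y c d, ex_RInt (fun s => F y s) c d)
    by (intros; apply ex_RInt_cont, (cont_section F y HF)).
  assert (HC : forall u v, continuity_2d_pt (fun u v => Derive (fun z => F z v) u) u v).
  { intros u v. apply continuity_2d_pt_ext with F'.
    - intros u' v'. symmetry. apply is_derive_unique, HD.
    - apply cont2_continuity_2d_pt, HF'. }
  evar_last.
  - apply (is_derive_RInt_param_bound_comp_aux3 F 0 (fun y => y) t 1).
    + apply filter_forall; auto.
    + exists (mkposreal 1 Rlt_0_1). apply filter_forall; auto.
    + apply (is_derive_id (K := R_AbsRing)).
    + exists (mkposreal 1 Rlt_0_1). apply filter_forall. intros; eexists; apply HD.
    + auto.
    + exists (mkposreal 1 Rlt_0_1); auto.
    + apply continuity_pt_filterlim. apply (cont_section F t HF t).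
  - rewrite (RInt_ext _ (F' t)); [simpl; ring |].
    intros s _. apply is_derive_unique, HD.
Qed.

Lemma is_derive_mult_R (h k : R -> R) (x dh dk : R) :
  is_derive h x dh -> is_derive k x dk ->
  is_derive (fun z => h z * k z) x (dh * k x + h x * dk).
Proof. intros; apply (is_derive_mult h k); auto using Rmult_comm. Qed.

Lemma is_derive_comp_R (h k : R -> R) (x dh dk : R) :
  is_derive h (k x) dh -> is_derive k x dk ->
  is_derive (fun z => h (k z)) x (dh * dk).
Proof. intros; rewrite Rmult_comm; apply (is_derive_comp h k); assumption. Qed.

(** * Duhamel integrals over the light cone *)

Definition phi (t b : R) : R := exp (- b) - exp (- t).

(* The substitution [y = x + phi t b * s] makes the domain of integration independent of [t]. *)
Definition slice (g : R -> R -> R) (V : R -> R -> R -> R) (x t b : R) : R :=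
  RInt (fun s => g (x + phi t b * s) b * V t b s) (-1) 1.

Definition duhamel (g : R -> R -> R) (V : R -> R -> R -> R) (x t : R) : R :=
  RInt (slice g V x t) 0 t.

(* The weight produced when [g (x + phi t b * s)] is differentiated in [t]. *)
Definition drift (V : R -> R -> R -> R) (t b s : R) : R := exp (- t) * s * V t b s.

Lemma cont3_drift V : cont3 V -> cont3 (drift V).
Proof. intros HV. unfold drift, cont3. cont_tac. Qed.

Section Operators.

Variables (g g' : R -> R -> R) (V V' : R -> R -> R -> R).
Hypotheses (Hg : cont2 g) (Hg' : cont2 g')
  (Dg : forall x b, is_derive (fun z => g z b) x (g' x b))
  (HV : cont3 V) (HV' : cont3 V')
  (DV : forall t b s, is_derive (fun z => V z b s) t (V' t b s)).

Lemma slice_cont : cont3 (slice g V).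
Proof.
  unfold cont3, slice.
  apply (cont_RInt (fun (p : R * R * R) s =>
    g (fst (fst p) + phi (snd (fst p)) (snd p) * s) (snd p) * V (snd (fst p)) (snd p) s)); [lra|].
  unfold phi. cont_tac.
Qed.

Lemma slice_ex_RInt x t b :
  ex_RInt (fun s => g (x + phi t b * s) b * V t b s) (-1) 1.
Proof. apply ex_RInt_cont. unfold phi. cont_tac. Qed.

Lemma slice_derive_x x t b :
  is_derive (fun z => slice g V z t b) x (slice g' V x t b).
Proof.
  apply (is_derive_RInt_cont (fun z s => g (z + phi t b * s) b * V t b s)
    (fun z s => g' (z + phi t b * s) b * V t b s)).
  - intros y s.
    evar_last.
    + apply is_derive_mult_R; [|apply is_derive_const].
      apply is_derive_comp_R with (h := fun z => g z b) (k := fun z => z + phi t b * s) (dk := 1).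
      * apply Dg.
      * auto_derive; [auto | ring].
    + unfold zero; simpl. ring.
  - unfold cont2, phi. cont_tac.
  - unfold cont2, phi. cont_tac.
Qed.

(** [t] acts twice: on the spatial argument, where [d phi / dt = e^{-t}] produces the weight
    [drift], and on [V]. The result is again a sum of slices, so the operation can be iterated. *)
Lemma slice_derive_t x t b :
  is_derive (fun z => slice g V x z b) t
    (slice g' (drift V) x t b + slice g V' x t b).
Proof.
  evar_last.
  - apply (is_derive_RInt_cont (fun z s => g (x + phi z b * s) b * V z b s)
    (fun z s => g' (x + phi z b * s) b * drift V z b s + g (x + phi z b * s) b * V' z b s)).
    + intros y s. unfold drift.
      evar_last.
      * apply is_derive_mult_R; [|apply DV].
        apply is_derive_comp_R with (h := fun z => g z b) (k := fun z => x + phi z b * s)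
          (dk := exp (- y) * s).
        -- apply Dg.
        -- unfold phi. auto_derive; [auto | ring].
      * simpl. ring.
    + unfold cont2, phi. cont_tac.
    + unfold cont2, phi, drift. cont_tac.
  - apply (RInt_plus (V := R_CompleteNormedModule)); apply ex_RInt_cont; unfold phi, drift; cont_tac.
Qed.

Lemma duhamel_cont : cont2 (duhamel g V).
Proof.
  assert (HS := slice_cont).
  unfold cont2.
  (* Substituting [b = t r] fixes the domain of the outer integral too, for every sign of [t] and
     for [t = 0]. *)
  apply (cont_ext (fun p : R * R =>
    RInt (fun r => snd p * slice g V (fst p) (snd p) (snd p * r)) 0 1)).
  - intros [x t]. simpl. unfold duhamel.
    rewrite <- (RInt_ext (fun r => scal t (slice g V x t (t * r + 0)))).
    + rewrite (RInt_comp_lin (V := R_CompleteNormedModule) (slice g V x t)).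
      * f_equal; ring.
      * apply ex_RInt_cont. cont_tac.
    + intros r _. rewrite Rplus_0_r. reflexivity.
  - apply (cont_RInt (fun (p : R * R) r => snd p * slice g V (fst p) (snd p) (snd p * r))); [lra|].
    cont_tac.
Qed.

End Operators.

Section OperatorDerivatives.

Variables (g g' : R -> R -> R) (V V' : R -> R -> R -> R).
Hypotheses (Hg : cont2 g) (Hg' : cont2 g')
  (Dg : forall x b, is_derive (fun z => g z b) x (g' x b))
  (HV : cont3 V) (HV' : cont3 V')
  (DV : forall t b s, is_derive (fun z => V z b s) t (V' t b s)).

Lemma duhamel_derive_x x t :
  is_derive (fun z => duhamel g V z t) x (duhamel g' V x t).
Proof.
  pose proof (slice_cont g V Hg HV) as H1.
  pose proof (slice_cont g' V Hg' HV) as H2.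
  apply (is_derive_RInt_cont (fun z b => slice g V z t b) (fun z b => slice g' V z t b)).
  - intros y b. apply slice_derive_x; assumption.
  - unfold cont2. cont_tac.
  - unfold cont2. cont_tac.
Qed.

Lemma duhamel_derive_t x t :
  is_derive (fun z => duhamel g V x z) t
    (slice g V x t t + (duhamel g' (drift V) x t + duhamel g V' x t)).
Proof.
  pose proof (slice_cont g V Hg HV) as H1.
  pose proof (slice_cont g' _ Hg' (cont3_drift V HV)) as H2.
  pose proof (slice_cont g V' Hg HV') as H3.
  evar_last.
  - apply (is_derive_RInt_upper (fun z b => slice g V x z b)
     (fun z b => slice g' (drift V) x z b + slice g V' x z b)).
    + intros y b. apply slice_derive_t; assumption.
    + unfold cont2. cont_tac.
    + unfold cont2. cont_tac.
  - simpl. f_equal.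
    apply (RInt_plus (V := R_CompleteNormedModule)); apply ex_RInt_cont; cont_tac.
Qed.

End OperatorDerivatives.

(** At [b = t] the cone shrinks to its apex since [phi t t = 0]; the factor [2] is the length of
    [[-1, 1]]. *)
Lemma slice_diagonal g V x t (v : R) :
  (forall s, V t t s = v) -> slice g V x t t = 2 * v * g x t.
Proof.
  intros Hv. unfold slice, phi.
  rewrite (RInt_ext _ (fun _ => g x t * v)).
  - rewrite RInt_const. unfold scal; simpl; unfold mult; simpl. ring.
  - intros s _. rewrite Hv. f_equal. f_equal. ring.
Qed.

(** * The kernel of a profile *)

(** [sh] and [ch] are the hyperbolic sine and cosine of half the argument. *)
Definition sh (z : R) : R := (exp (z / 2) - exp (- (z / 2))) / 2.
Definition ch (z : R) : R := (exp (z / 2) + exp (- (z / 2))) / 2.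

Lemma sh_0 : sh 0 = 0.
Proof. unfold sh. replace (- (0 / 2)) with (0 / 2) by field. field. Qed.

Lemma ch_0 : ch 0 = 1.
Proof.
  unfold ch. replace (0 / 2) with 0 by field. rewrite Ropp_0, exp_0. field.
Qed.

Lemma is_derive_sh z : is_derive sh z (ch z / 2).
Proof. unfold sh, ch. auto_derive; [auto | unfold Rdiv; field]. Qed.

Lemma is_derive_ch z : is_derive ch z (sh z / 2).
Proof. unfold sh, ch. auto_derive; [auto | unfold Rdiv; field]. Qed.

Lemma ch_sqr z : ch z * ch z = 1 + sh z * sh z.
Proof.
  unfold ch, sh.
  assert (H : exp (z / 2) * exp (- (z / 2)) = 1)
    by (rewrite <- exp_plus, Rplus_opp_r; apply exp_0).
  nra.
Qed.

Lemma ch_minus_sh z : ch z - sh z = exp (- (z / 2)).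
Proof. unfold ch, sh. field. Qed.

Lemma ch_plus_sh z : ch z + sh z = exp (z / 2).
Proof. unfold ch, sh. field. Qed.

Lemma cont_sh {U : UniformSpace} (F : U -> R) : cont F -> cont (fun p => sh (F p)).
Proof.
  apply cont_comp. intros p. apply (ex_derive_continuous sh). eexists; apply is_derive_sh.
Qed.

Lemma cont_ch {U : UniformSpace} (F : U -> R) : cont F -> cont (fun p => ch (F p)).
Proof.
  apply cont_comp. intros p. apply (ex_derive_continuous ch). eexists; apply is_derive_ch.
Qed.

(* [1 - s ^ 2] for [-1 <= s <= 1], truncated outside so that profiles, which are only
   controlled on [0 <= w], can be evaluated at every [s]. *)
Definition cap (s : R) : R := (1 - s * s + Rabs (1 - s * s)) / 2.

Lemma cap_nonneg s : 0 <= cap s.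
Proof. unfold cap. unfold Rabs. destruct Rcase_abs; lra. Qed.

Lemma cap_inside s : -1 <= s <= 1 -> cap s = 1 - s * s.
Proof. intros H. unfold cap. rewrite Rabs_pos_eq; nra. Qed.

Lemma cont_cap {U : UniformSpace} (F : U -> R) : cont F -> cont (fun p => cap (F p)).
Proof.
  apply cont_comp. intros p. unfold cap. generalize (F p).
  change (cont (fun p : R => (1 - p * p + Rabs (1 - p * p)) / 2)).
  unfold Rdiv. apply cont_mult; [apply cont_plus|]; [cont_tac| |cont_tac].
  apply cont_comp; [intros; apply continuous_Rabs | cont_tac].
Qed.

(** Legendre's equation of degree [nu = -1/2 + i M] in the variable [1 + 2 w], real because
    [nu (nu + 1) = - 1/4 - M^2]. Derivatives at [w = 0] are two-sided, since [flux] passes through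
    [w = 0] at [s = 1] and [s = -1]. *)
Record profile (M : R) (P P' P'' : R -> R) : Prop := {
  profile_d1 : forall w, 0 <= w -> is_derive P w (P' w);
  profile_d2 : forall w, 0 <= w -> is_derive P' w (P'' w);
  profile_cont : forall w, 0 <= w -> continuous P'' w;
  profile_ode : forall w, 0 <= w ->
    w * (1 + w) * P'' w + (1 + 2 * w) * P' w + (1 / 4 + M ^ 2) * P w = 0 }.

Section Kernel.

Variables (M : R) (P P' P'' : R -> R).
Hypothesis HP : profile M P P' P''.

Definition arg (t b s : R) : R := cap s * sh (t - b) ^ 2.

Definition ker0 (t b s : R) : R := sh (t - b) * P (arg t b s).

(** [ker1] and [ker2] are the first and second [t]-derivatives of [ker0]. *)
Definition ker1 (t b s : R) : R :=
  ch (t - b) / 2 * P (arg t b s)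
  + cap s * sh (t - b) ^ 2 * ch (t - b) * P' (arg t b s).

Definition ker2 (t b s : R) : R :=
  sh (t - b) / 4 * P (arg t b s)
  + cap s * sh (t - b) * (3 / 2 * ch (t - b) ^ 2 + sh (t - b) ^ 2 / 2) * P' (arg t b s)
  + cap s ^ 2 * sh (t - b) ^ 3 * ch (t - b) ^ 2 * P'' (arg t b s).

Lemma arg_nonneg t b s : 0 <= arg t b s.
Proof. apply Rmult_le_pos; [apply cap_nonneg | apply pow2_ge_0]. Qed.

Lemma cont_arg {U : UniformSpace} (F G H : U -> R) :
  cont F -> cont G -> cont H -> cont (fun p => arg (F p) (G p) (H p)).
Proof.
  intros HF HG HH. unfold arg. apply cont_mult; [apply cont_cap; exact HH|].
  apply cont_pow, cont_sh. cont_tac.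
Qed.

Lemma cont_profile {U : UniformSpace} (F G H : U -> R) :
  cont F -> cont G -> cont H -> cont (fun p => P (arg (F p) (G p) (H p))).
Proof.
  intros HF HG HH. apply (cont_comp P); [|apply cont_arg; assumption].
  intros p. apply (ex_derive_continuous P). eexists; apply (profile_d1 _ _ _ _ HP), arg_nonneg.
Qed.

Lemma cont_profile' {U : UniformSpace} (F G H : U -> R) :
  cont F -> cont G -> cont H -> cont (fun p => P' (arg (F p) (G p) (H p))).
Proof.
  intros HF HG HH. apply (cont_comp P'); [|apply cont_arg; assumption].
  intros p. apply (ex_derive_continuous P'). eexists; apply (profile_d2 _ _ _ _ HP), arg_nonneg.
Qed.

Lemma cont_profile'' {U : UniformSpace} (F G H : U -> R) :
  cont F -> cont G -> cont H -> cont (fun p => P'' (arg (F p) (G p) (H p))).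
Proof.
  intros HF HG HH. apply (cont_comp P''); [|apply cont_arg; assumption].
  intros p. apply (profile_cont _ _ _ _ HP), arg_nonneg.
Qed.

Ltac cont_ker :=
  unfold cont3; cbn [fst snd]; unfold Rdiv;
  repeat first [ cont_step | match goal with
    | |- cont (fun p => sh _) => apply cont_sh
    | |- cont (fun p => ch _) => apply cont_ch
    | |- cont (fun p => cap _) => apply cont_cap
    | |- cont (fun p => P _) => apply cont_profile
    | |- cont (fun p => P' _) => apply cont_profile'
    | |- cont (fun p => P'' _) => apply cont_profile''
    end ].

Lemma cont3_ker0 : cont3 ker0.
Proof. unfold ker0. cont_ker. Qed.

Lemma cont3_ker1 : cont3 ker1.
Proof. unfold ker1. cont_ker. Qed.

Lemma cont3_ker2 : cont3 ker2.
Proof. unfold ker2. cont_ker. Qed.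

Lemma is_derive_sh_shift t b : is_derive (fun z => sh (z - b)) t (ch (t - b) / 2).
Proof.
  evar_last.
  - apply is_derive_comp_R with (h := sh) (k := fun z => z - b) (dk := 1);
      [apply is_derive_sh | auto_derive; [auto | ring]].
  - simpl; ring.
Qed.

Lemma is_derive_ch_shift t b : is_derive (fun z => ch (z - b)) t (sh (t - b) / 2).
Proof.
  evar_last.
  - apply is_derive_comp_R with (h := ch) (k := fun z => z - b) (dk := 1);
      [apply is_derive_ch | auto_derive; [auto | ring]].
  - simpl; ring.
Qed.

Lemma is_derive_pow2 (h : R -> R) (x dh : R) :
  is_derive h x dh -> is_derive (fun z => h z ^ 2) x (2 * h x * dh).
Proof.
  intros H. evar_last.
  - apply (is_derive_pow h 2 x dh H).
  - simpl. ring.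
Qed.

Lemma is_derive_scal_R (h : R -> R) (x k dh : R) :
  is_derive h x dh -> is_derive (fun z => k * h z) x (k * dh).
Proof. apply is_derive_scal. Qed.

Lemma is_derive_plus_R (h k : R -> R) (x dh dk : R) :
  is_derive h x dh -> is_derive k x dk -> is_derive (fun z => h z + k z) x (dh + dk).
Proof. apply (is_derive_plus h k). Qed.

Lemma is_derive_arg t b s :
  is_derive (fun z => arg z b s) t (cap s * sh (t - b) * ch (t - b)).
Proof.
  unfold arg. evar_last.
  - apply is_derive_scal_R, is_derive_pow2, is_derive_sh_shift.
  - simpl; field.
Qed.

Lemma is_derive_ker0 t b s : is_derive (fun z => ker0 z b s) t (ker1 t b s).
Proof.
  unfold ker0. evar_last.
  - apply is_derive_mult_R; [apply is_derive_sh_shift|].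
    apply is_derive_comp_R with (h := P) (k := fun z => arg z b s).
    + apply (profile_d1 _ _ _ _ HP), arg_nonneg.
    + apply is_derive_arg.
  - unfold ker1. simpl; field.
Qed.

Lemma is_derive_ker1 t b s : is_derive (fun z => ker1 z b s) t (ker2 t b s).
Proof.
  unfold ker1, Rdiv. evar_last.
  - apply is_derive_plus_R; (apply is_derive_mult_R; [|
      apply is_derive_comp_R with (k := fun z => arg z b s);
      [| apply is_derive_arg]]).
    + apply is_derive_mult_R; [apply is_derive_ch_shift | apply (is_derive_const (V := R_NormedModule))].
    + apply (profile_d1 _ _ _ _ HP), arg_nonneg.
    + apply is_derive_mult_R; [|apply is_derive_ch_shift].
      apply is_derive_scal_R, is_derive_pow2, is_derive_sh_shift.
    + apply (profile_d2 _ _ _ _ HP), arg_nonneg.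
  - unfold ker2. change (@zero R_NormedModule) with 0. simpl. field.
Qed.

Lemma ker0_diagonal t s : ker0 t t s = 0.
Proof. unfold ker0. rewrite Rminus_diag, sh_0. ring. Qed.

Lemma ker1_diagonal t s : ker1 t t s = P 0 / 2.
Proof.
  unfold ker1, arg. rewrite Rminus_diag, sh_0, ch_0.
  replace (cap s * 0 ^ 2) with 0 by ring. field.
Qed.

Definition drift' (t b s : R) : R := - (exp (- t) * s * ker0 t b s) + exp (- t) * s * ker1 t b s.

Lemma is_derive_drift t b s : is_derive (fun z => drift ker0 z b s) t (drift' t b s).
Proof.
  unfold drift. evar_last.
  - apply is_derive_mult_R; [|apply is_derive_ker0].
    instantiate (1 := - exp (- t) * s). auto_derive; [auto | ring].
  - unfold drift'. simpl. ring.
Qed.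

Lemma cont3_drift' : cont3 drift'.
Proof.
  pose proof cont3_ker0. pose proof cont3_ker1. unfold drift', cont3. cont_tac.
Qed.

End Kernel.

(** * The wave equation for Duhamel integrals of a profile kernel *)

(** The algebra of the exact derivative, separated from the analysis: [S], [C] stand for [sh], [ch]
    at [t - b], [q] for [e^{-t}], [E] for [e^{(t+b)/2}], [P0], [P1], [P2] for the profile and its
    derivatives, [d0], [d1], [d2] for the source and its [x]-derivatives. On the left is the
    [s]-derivative of the flux, on the right the wave operator on the integrand. *)
Lemma divergence_identity (M S C q E c s P0 P1 P2 d0 d1 d2 ph : R) :
  C * C = 1 + S * S -> q * E = C - S -> ph = 2 * q * S * (C + S) -> c = 1 - s * s ->
  c * S ^ 2 * (1 + c * S ^ 2) * P2 + (1 + 2 * (c * S ^ 2)) * P1 + (1 / 4 + M ^ 2) * P0 = 0 ->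
  (d2 * ph) * (- 1 / 2 * q * q * E * (c * P0))
  + d1 * (- 1 / 2 * q * q * E * (- 2 * s * P0 + c * (P1 * (-2 * s * S ^ 2))))
  + ((d1 * ph) * (1 / 2 * S * (s * c * P1))
  + d0 * (1 / 2 * S * ((1 - 3 * s * s) * P1 + s * c * (P2 * (-2 * s * S ^ 2))))) =
  d2 * (q * s * (q * s * (S * P0)))
  + d1 * (- (q * s * (S * P0)) + q * s * (C / 2 * P0 + c * S ^ 2 * C * P1))
  + d1 * (q * s * (C / 2 * P0 + c * S ^ 2 * C * P1))
  + d0 * (S / 4 * P0 + c * S * (3 / 2 * C ^ 2 + S ^ 2 / 2) * P1 + c ^ 2 * S ^ 3 * C ^ 2 * P2)
  - (q * q) * (d2 * (S * P0)) + M ^ 2 * (d0 * (S * P0)).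
Proof.
  intros HC HE Hph Hc Hode.
  replace (C ^ 2) with (1 + S * S) by (rewrite <- HC; ring).
  replace (-1 / 2 * q * q * E) with (-1 / 2 * q * (C - S)) by (rewrite <- HE; ring).
  (* [(C - S) (C + S) = 1] removes [ph] from the [d2] term. *)
  assert (H1 : (C - S) * ph = 2 * q * S)
    by (transitivity (2 * q * S * (C * C - S * S)); [rewrite Hph; ring | rewrite HC; ring]).
  transitivity (d2 * (-1 / 2 * q * c * P0) * ((C - S) * ph)
    + d1 * (- 1 / 2 * q * (C - S) * (- 2 * s * P0 + c * (P1 * (-2 * s * S ^ 2))))
  + ((d1 * ph) * (1 / 2 * S * (s * c * P1))
  + d0 * (1 / 2 * S * ((1 - 3 * s * s) * P1 + s * c * (P2 * (-2 * s * S ^ 2)))))); [ring|].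
  rewrite H1, Hph.
  (* The [d2] and [d1] terms now agree; what is left is [d0 * S] times the profile equation. *)
  match goal with |- ?l = ?r =>
    enough (r - l = d0 * S * (c * S ^ 2 * (1 + c * S ^ 2) * P2
      + (1 + 2 * (c * S ^ 2)) * P1 + (1 / 4 + M ^ 2) * P0)) by (rewrite Hode in *; lra) end.
  rewrite Hc. field [HC].
Qed.

Lemma is_RInt_plus_R (h k : R -> R) (a b l m : R) :
  is_RInt h a b l -> is_RInt k a b m -> is_RInt (fun s => h s + k s) a b (l + m).
Proof. apply (is_RInt_plus h k). Qed.

Lemma is_RInt_minus_R (h k : R -> R) (a b l m : R) :
  is_RInt h a b l -> is_RInt k a b m -> is_RInt (fun s => h s - k s) a b (l - m).
Proof. apply (is_RInt_minus h k). Qed.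

Lemma is_RInt_scal_R (h : R -> R) (a b k l : R) :
  is_RInt h a b l -> is_RInt (fun s => k * h s) a b (k * l).
Proof. apply (is_RInt_scal h). Qed.

(** The six terms of the wave operator in one shape for two uses: integration in [s] within a slice
    and in [b] over the slices. *)
Lemma RInt_combination (h1 h2 h3 h4 h5 h6 : R -> R) (k m a b r : R) :
  ex_RInt h1 a b -> ex_RInt h2 a b -> ex_RInt h3 a b -> ex_RInt h4 a b ->
  ex_RInt h5 a b -> ex_RInt h6 a b ->
  is_RInt (fun s => h1 s + h2 s + h3 s + h4 s - k * h5 s + m * h6 s) a b r ->
  RInt h1 a b + RInt h2 a b + RInt h3 a b + RInt h4 a b
    - k * RInt h5 a b + m * RInt h6 a b = r.
Proof.
  intros E1 E2 E3 E4 E5 E6 HR.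
  rewrite <- (is_RInt_unique (V := R_CompleteNormedModule) _ _ _ _ HR).
  symmetry. apply (is_RInt_unique (V := R_CompleteNormedModule)).
  apply is_RInt_plus_R; [apply is_RInt_minus_R|].
  1: apply is_RInt_plus_R; [apply is_RInt_plus_R; [apply is_RInt_plus_R|]|].
  5-6: apply is_RInt_scal_R.
  all: apply (RInt_correct (V := R_CompleteNormedModule)); assumption.
Qed.

Record C2_partials (u ux ut uxx uxt utx utt : R -> R -> R) : Prop := {
  C2_x : forall x t, is_derive (fun z => u z t) x (ux x t);
  C2_t : forall x t, is_derive (fun z => u x z) t (ut x t);
  C2_xx : forall x t, is_derive (fun z => ux z t) x (uxx x t);
  C2_xt : forall x t, is_derive (fun z => ux x z) t (uxt x t);
  C2_tx : forall x t, is_derive (fun z => ut z t) x (utx x t);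
  C2_tt : forall x t, is_derive (fun z => ut x z) t (utt x t);
  C2_cont : cont2 u;
  C2_cont_x : cont2 ux;
  C2_cont_t : cont2 ut;
  C2_cont_xx : cont2 uxx;
  C2_cont_xt : cont2 uxt;
  C2_cont_tx : cont2 utx;
  C2_cont_tt : cont2 utt }.

Definition wave_solution (M : R) (F u : R -> R -> R) : Prop :=
  exists ux ut uxx uxt utx utt,
    C2_partials u ux ut uxx uxt utx utt /\
    (forall x t, utt x t - exp (- t) * exp (- t) * uxx x t + M ^ 2 * u x t = F x t) /\
    (forall x, u x 0 = 0 /\ ut x 0 = 0).

Section WaveEquation.

Variables (M : R) (P P' P'' : R -> R) (g g1 g2 : R -> R -> R).
Hypotheses (HP : profile M P P' P'')
  (Hg : cont2 g) (Hg1 : cont2 g1) (Hg2 : cont2 g2)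
  (Dg : forall x b, is_derive (fun z => g z b) x (g1 x b))
  (Dg1 : forall x b, is_derive (fun z => g1 z b) x (g2 x b)).

Let W := ker0 P.
Let W1 := ker1 P P'.
Let W2 := ker2 P P' P''.
Let W' := drift' P P'.

Let HW : cont3 W := cont3_ker0 M P P' P'' HP.
Let HW1 : cont3 W1 := cont3_ker1 M P P' P'' HP.
Let HW2 : cont3 W2 := cont3_ker2 M P P' P'' HP.
Let HW' : cont3 W' := cont3_drift' M P P' P'' HP.
Let DW : forall t b s, is_derive (fun z => W z b s) t (W1 t b s) :=
  is_derive_ker0 M P P' P'' HP.
Let DW1 : forall t b s, is_derive (fun z => W1 z b s) t (W2 t b s) :=
  is_derive_ker1 M P P' P'' HP.
Let DdW : forall t b s, is_derive (fun z => drift W z b s) t (W' t b s) :=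
  is_derive_drift M P P' P'' HP.

(* The two coefficients come from matching the terms in [g2] and [g1] of the wave operator
   applied to [g (x + phi t b * s) b * ker0 P t b s]; matching the term in [g] is then the
   equation for the profile. *)
Definition flux (x t b s : R) : R :=
  g1 (x + phi t b * s) b
    * (- 1 / 2 * exp (- t) * exp (- t) * exp ((t + b) / 2)
       * ((1 - s * s) * P ((1 - s * s) * sh (t - b) ^ 2)))
  + g (x + phi t b * s) b
    * (1 / 2 * sh (t - b) * (s * (1 - s * s) * P' ((1 - s * s) * sh (t - b) ^ 2))).

(** The factor [ch + sh] is [e^{(t-b)/2}], kept in this form because it cancels against the
    [ch - sh] hidden in the flux coefficient. *)
Lemma phi_sh t b :
  phi t b = 2 * exp (- t) * sh (t - b) * (ch (t - b) + sh (t - b)).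
Proof.
  rewrite ch_plus_sh. unfold sh, phi.
  transitivity (exp (- t) * (exp ((t - b) / 2) * exp ((t - b) / 2)
    - exp ((t - b) / 2) * exp (- ((t - b) / 2)))); [|field].
  rewrite <- !exp_plus.
  replace ((t - b) / 2 + - ((t - b) / 2)) with 0 by ring.
  rewrite Rmult_minus_distr_l, <- !exp_plus. f_equal; [|f_equal]; f_equal; field.
Qed.

(** The flux carries [1 - s * s] where the kernel carries [cap s]: the fundamental theorem is
    applied with two-sided derivatives at the endpoints too, where [cap] has corners. On [[-1, 1]]
    the two agree. *)
Lemma is_derive_flux x t b s : -1 <= s <= 1 ->
  is_derive (flux x t b) s
    (g2 (x + phi t b * s) b * drift (drift W) t b s
     + g1 (x + phi t b * s) b * W' t b s
     + g1 (x + phi t b * s) b * drift W1 t b s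
     + g (x + phi t b * s) b * W2 t b s
     - exp (- t) * exp (- t) * (g2 (x + phi t b * s) b * W t b s)
     + M ^ 2 * (g (x + phi t b * s) b * W t b s)).
Proof.
  intros Hs. set (w := fun r => (1 - r * r) * sh (t - b) ^ 2).
  assert (Hw : 0 <= w s) by (apply Rmult_le_pos; [nra | apply pow2_ge_0]).
  assert (Dw : is_derive w s (-2 * s * sh (t - b) ^ 2))
    by (unfold w; auto_derive; [auto | ring]).
  assert (Dl : is_derive (fun r => x + phi t b * r) s (phi t b))
    by (auto_derive; [auto | ring]).
  unfold flux. evar_last.
  - apply is_derive_plus_R; apply is_derive_mult_R.
    + apply is_derive_comp_R with (h := fun z => g1 z b) (2 := Dl). apply Dg1.
    + apply is_derive_scal_R. apply is_derive_mult_R.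
      * instantiate (1 := -2 * s). auto_derive; [auto | ring].
      * apply is_derive_comp_R with (k := w) (2 := Dw). apply (profile_d1 _ _ _ _ HP), Hw.
    + apply is_derive_comp_R with (h := fun z => g z b) (2 := Dl). apply Dg.
    + apply is_derive_scal_R. apply is_derive_mult_R.
      * instantiate (1 := 1 - 3 * s * s). auto_derive; [auto | ring].
      * apply is_derive_comp_R with (k := w) (2 := Dw). apply (profile_d2 _ _ _ _ HP), Hw.
  - unfold W, W1, W2, W', drift', drift, ker0, ker1, ker2, arg.
    rewrite cap_inside by assumption.
    refine (eq_trans _ (divergence_identity M (sh (t - b)) (ch (t - b)) (exp (- t))
      (exp ((t + b) / 2)) (1 - s * s) s (P (w s)) (P' (w s)) (P'' (w s))
      (g (x + phi t b * s) b) (g1 (x + phi t b * s) b) (g2 (x + phi t b * s) b)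
      (phi t b) _ _ _ _ _)).
    + reflexivity.
    + apply ch_sqr.
    + rewrite ch_minus_sh, <- exp_plus. f_equal. field.
    + apply phi_sh.
    + reflexivity.
    + apply (profile_ode _ _ _ _ HP), Hw.
Qed.

Lemma slice_wave x t b :
  slice g2 (drift (drift W)) x t b + slice g1 W' x t b + slice g1 (drift W1) x t b
    + slice g W2 x t b - exp (- t) * exp (- t) * slice g2 W x t b
    + M ^ 2 * slice g W x t b = 0.
Proof.
  pose proof (cont3_drift W HW) as HdW.
  pose proof (cont3_drift _ HdW) as HddW.
  pose proof (cont3_drift W1 HW1) as HdW1.
  apply RInt_combination.
  1-6: apply slice_ex_RInt; assumption.
  replace 0 with (minus (flux x t b 1) (flux x t b (-1))).
  - apply (is_RInt_derive (V := R_CompleteNormedModule) (flux x t b)).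
    + rewrite Rmin_left, Rmax_right by lra. intros s Hs. apply is_derive_flux, Hs.
    + intros s _. revert s.
      refine (_ : cont (fun s => _)). cont_tac.
  - unfold flux, minus, plus, opp; simpl. ring.
Qed.

Lemma duhamel_wave x t :
  duhamel g2 (drift (drift W)) x t + duhamel g1 W' x t + duhamel g1 (drift W1) x t
    + duhamel g W2 x t - exp (- t) * exp (- t) * duhamel g2 W x t
    + M ^ 2 * duhamel g W x t = 0.
Proof.
  pose proof (cont3_drift W HW) as HdW.
  pose proof (cont3_drift _ HdW) as HddW.
  pose proof (cont3_drift W1 HW1) as HdW1.
  pose proof (slice_cont g2 _ Hg2 HddW) as C1.
  pose proof (slice_cont g1 _ Hg1 HW') as C2.
  pose proof (slice_cont g1 _ Hg1 HdW1) as C3.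
  pose proof (slice_cont g _ Hg HW2) as C4.
  pose proof (slice_cont g2 _ Hg2 HW) as C5.
  pose proof (slice_cont g _ Hg HW) as C6.
  apply RInt_combination.
  1-6: apply ex_RInt_cont; cont_tac.
  apply (is_RInt_ext (fun _ => 0)).
  - intros b _. symmetry. apply slice_wave.
  - evar_last; [apply (is_RInt_const (V := R_NormedModule)) | apply Rmult_0_r].
Qed.

Lemma wave_solution_duhamel :
  wave_solution M (fun x t => P 0 * g x t) (duhamel g W).
Proof.
  pose proof (cont3_drift W HW) as HdW.
  pose proof (cont3_drift _ HdW) as HddW.
  pose proof (cont3_drift W1 HW1) as HdW1.
  assert (W_diag : forall h x t, slice h W x t t = 0).
  { intros h x t. rewrite (slice_diagonal h W x t 0); [ring | apply ker0_diagonal]. }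
  assert (dW_diag : forall h x t, slice h (drift W) x t t = 0).
  { intros h x t. rewrite (slice_diagonal h (drift W) x t 0); [ring |].
    intros s. unfold drift, W. rewrite ker0_diagonal. ring. }
  assert (W1_diag : forall x t, slice g W1 x t t = P 0 * g x t).
  { intros x t. rewrite (slice_diagonal g W1 x t (P 0 / 2)); [field | apply ker1_diagonal]. }
  (* An [x]-derivative moves [g] to [g1] and [g1] to [g2]; a [t]-derivative sends a pair [(g, V)] to
     [(g', drift V)] plus [(g, V')]. The boundary value [P 0 * g] enters [u_tt] alone. *)
  exists (duhamel g1 W), (fun x t => duhamel g1 (drift W) x t + duhamel g W1 x t),
    (duhamel g2 W), (fun x t => duhamel g2 (drift W) x t + duhamel g1 W1 x t),
    (fun x t => duhamel g2 (drift W) x t + duhamel g1 W1 x t),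
    (fun x t => (duhamel g2 (drift (drift W)) x t + duhamel g1 W' x t)
       + (P 0 * g x t + (duhamel g1 (drift W1) x t + duhamel g W2 x t))).
  split; [split | split].
  - intros x t. apply duhamel_derive_x; assumption.
  - intros x t. evar_last; [apply duhamel_derive_t with (g' := g1) (V' := W1); assumption|].
    rewrite W_diag. apply Rplus_0_l.
  - intros x t. apply duhamel_derive_x; assumption.
  - intros x t. evar_last; [apply duhamel_derive_t with (g' := g2) (V' := W1); assumption|].
    rewrite W_diag. apply Rplus_0_l.
  - intros x t. apply is_derive_plus_R; apply duhamel_derive_x; assumption.
  - intros x t. apply is_derive_plus_R.
    + evar_last; [apply duhamel_derive_t with (g' := g2) (V' := W'); assumption|].
      rewrite dW_diag. apply Rplus_0_l.
    + evar_last; [apply duhamel_derive_t with (g' := g1) (V' := W2); assumption|].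
      rewrite W1_diag. reflexivity.
  - apply duhamel_cont; assumption.
  - apply duhamel_cont; assumption.
  - apply cont_plus; apply duhamel_cont; assumption.
  - apply duhamel_cont; assumption.
  - apply cont_plus; apply duhamel_cont; assumption.
  - apply cont_plus; apply duhamel_cont; assumption.
  - apply cont_plus; [apply cont_plus; apply duhamel_cont; assumption|].
    apply cont_plus; [unfold cont2; cont_tac | apply cont_plus; apply duhamel_cont; assumption].
  - intros x t. pose proof (duhamel_wave x t). lra.
  - intros x. unfold duhamel. rewrite !RInt_point. unfold zero; simpl. split; ring.
Qed.

End WaveEquation.

Lemma wave_solution_plus M F G u v :
  wave_solution M F u -> wave_solution M G v ->
  wave_solution M (fun x t => F x t + G x t) (fun x t => u x t + v x t).
Proof.
  intros (ux & ut & uxx & uxt & utx & utt & Hu & Eu & Iu)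
    (vx & vt & vxx & vxt & vtx & vtt & Hv & Ev & Iv).
  exists (fun x t => ux x t + vx x t), (fun x t => ut x t + vt x t),
    (fun x t => uxx x t + vxx x t), (fun x t => uxt x t + vxt x t),
    (fun x t => utx x t + vtx x t), (fun x t => utt x t + vtt x t).
  destruct Hu, Hv. split; [|split; [|split]].
  - split; try (intros; apply is_derive_plus_R; auto); apply cont_plus; assumption.
  - intros x t. rewrite <- Eu, <- Ev. ring.
  - destruct (Iu x) as [-> _], (Iv x) as [-> _]. ring.
  - destruct (Iu x) as [_ ->], (Iv x) as [_ ->]. ring.
Qed.

Lemma wave_solution_opp M F u :
  wave_solution M F u -> wave_solution M (fun x t => - F x t) (fun x t => - u x t).
Proof.
  intros (ux & ut & uxx & uxt & utx & utt & Hu & Eu & Iu).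
  exists (fun x t => - ux x t), (fun x t => - ut x t), (fun x t => - uxx x t),
    (fun x t => - uxt x t), (fun x t => - utx x t), (fun x t => - utt x t).
  destruct Hu.
  assert (HD : forall (h : R -> R) (y l : R), is_derive h y l -> is_derive (fun z => - h z) y (- l))
    by (intros h y l; apply (is_derive_opp h)).
  split; [|split; [|split]].
  - split; try (intros; apply HD; auto); apply cont_opp; assumption.
  - intros x t. rewrite <- Eu. ring.
  - destruct (Iu x) as [-> _]. ring.
  - destruct (Iu x) as [_ ->]. ring.
Qed.

(** * From the hypergeometric equation to the profile equation *)

Section ProfileOfSystem.

(** [EX] and [EY] are the real and imaginary parts of Gauss's equation for [X + i Y] with
    [a = b = 1/2 + i M], [c = 1]: here [a + b + 1 = 2 + 2 i M] and [a b = 1/4 - M^2 + i M]. *)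
Variables (M : R) (X X1 X2 Y Y1 Y2 : R -> R).
Hypotheses
  (DX : forall z, 0 <= z < 1 -> is_derive X z (X1 z))
  (DX1 : forall z, 0 <= z < 1 -> is_derive X1 z (X2 z))
  (DX2 : forall z, 0 <= z < 1 -> ex_derive X2 z)
  (DY : forall z, 0 <= z < 1 -> is_derive Y z (Y1 z))
  (DY1 : forall z, 0 <= z < 1 -> is_derive Y1 z (Y2 z))
  (DY2 : forall z, 0 <= z < 1 -> ex_derive Y2 z)
  (EX : forall z, 0 <= z < 1 ->
     z * (1 - z) * X2 z + (1 - 2 * z) * X1 z + 2 * M * z * Y1 z
       - (1 / 4 - M ^ 2) * X z + M * Y z = 0)
  (EY : forall z, 0 <= z < 1 ->
     z * (1 - z) * Y2 z + (1 - 2 * z) * Y1 z - 2 * M * z * X1 z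
       - (1 / 4 - M ^ 2) * Y z - M * X z = 0).

(* The real part of [(1 + w) ^ (- 1 / 2 - i M) * (a + i b)]. *)
Definition rot (w a b : R) : R :=
  exp (- (ln (1 + w) / 2)) * (cos (M * ln (1 + w)) * a + sin (M * ln (1 + w)) * b).

Definition zeta (w : R) : R := w / (1 + w).

Lemma zeta_bounds w : 0 <= w -> 0 <= zeta w < 1.
Proof.
  intros Hw. unfold zeta. split.
  - apply Rmult_le_pos; [lra | apply Rlt_le, Rinv_0_lt_compat; lra].
  - apply Rmult_lt_reg_r with (1 + w); [lra|]. field_simplify; lra.
Qed.

(** The power has logarithmic derivative [(-1/2 - i M) / (1 + w)], so differentiation acts on
    [(a, b)] and keeps the shape [rot]. *)
Lemma is_derive_rot (a b : R -> R) (w da db : R) : 0 <= w ->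
  is_derive a w da -> is_derive b w db ->
  is_derive (fun v => rot v (a v) (b v)) w
    (rot w ((- 1 / 2 * a w + M * b w) / (1 + w) + da)
           ((- 1 / 2 * b w - M * a w) / (1 + w) + db)).
Proof.
  intros Hw Da Db. unfold rot.
  assert (Ea : ex_derive a w) by (eexists; exact Da).
  assert (Eb : ex_derive b w) by (eexists; exact Db).
  auto_derive.
  - repeat split; auto; lra.
  - replace (Derive (fun v : R => a v) w) with da by (symmetry; apply is_derive_unique, Da).
    replace (Derive (fun v : R => b v) w) with db by (symmetry; apply is_derive_unique, Db).
    unfold Rdiv. field. lra.
Qed.

Lemma is_derive_comp_zeta (h h1 : R -> R) w : 0 <= w ->
  (forall z, 0 <= z < 1 -> is_derive h z (h1 z)) ->
  is_derive (fun v => h (zeta v)) w (h1 (zeta w) / (1 + w) ^ 2).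
Proof.
  intros Hw Dh. evar_last.
  - apply is_derive_comp_R with (k := zeta); [apply Dh, zeta_bounds, Hw|].
    instantiate (1 := / (1 + w) ^ 2).
    unfold zeta. auto_derive; [lra | field; lra].
  - reflexivity.
Qed.

(* The real part of [(1 + w) ^ (- 1 / 2 - i M) * (X + i Y) (w / (1 + w))]. *)
Definition prof (w : R) : R := rot w (X (zeta w)) (Y (zeta w)).

Definition prof1a (w : R) : R :=
  (- 1 / 2 * X (zeta w) + M * Y (zeta w)) / (1 + w) + X1 (zeta w) / (1 + w) ^ 2.
Definition prof1b (w : R) : R :=
  (- 1 / 2 * Y (zeta w) - M * X (zeta w)) / (1 + w) + Y1 (zeta w) / (1 + w) ^ 2.

Definition prof1 (w : R) : R := rot w (prof1a w) (prof1b w).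

(** [prof2a] and [prof2b] are the derivatives of [prof1a] and [prof1b], not the arguments of [rot]
    in [prof2]. *)
Definition prof2a (w : R) : R :=
  (- 1 / 2 * X1 (zeta w) + M * Y1 (zeta w)) / (1 + w) ^ 3
  - (- 1 / 2 * X (zeta w) + M * Y (zeta w)) / (1 + w) ^ 2
  + X2 (zeta w) / (1 + w) ^ 4 - 2 * X1 (zeta w) / (1 + w) ^ 3.
Definition prof2b (w : R) : R :=
  (- 1 / 2 * Y1 (zeta w) - M * X1 (zeta w)) / (1 + w) ^ 3
  - (- 1 / 2 * Y (zeta w) - M * X (zeta w)) / (1 + w) ^ 2
  + Y2 (zeta w) / (1 + w) ^ 4 - 2 * Y1 (zeta w) / (1 + w) ^ 3.

Definition prof2 (w : R) : R :=
  rot w ((- 1 / 2 * prof1a w + M * prof1b w) / (1 + w) + prof2a w)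
        ((- 1 / 2 * prof1b w - M * prof1a w) / (1 + w) + prof2b w).

Lemma profile_prof : profile M prof prof1 prof2.
Proof.
  assert (HX : forall w, 0 <= w -> is_derive (fun v => X (zeta v)) w (X1 (zeta w) / (1 + w) ^ 2))
    by (intros; apply is_derive_comp_zeta; auto).
  assert (HX1 : forall w, 0 <= w -> is_derive (fun v => X1 (zeta v)) w (X2 (zeta w) / (1 + w) ^ 2))
    by (intros; apply is_derive_comp_zeta; auto).
  assert (HY : forall w, 0 <= w -> is_derive (fun v => Y (zeta v)) w (Y1 (zeta w) / (1 + w) ^ 2))
    by (intros; apply is_derive_comp_zeta; auto).
  assert (HY1 : forall w, 0 <= w -> is_derive (fun v => Y1 (zeta v)) w (Y2 (zeta w) / (1 + w) ^ 2))
    by (intros; apply is_derive_comp_zeta; auto).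
  assert (EXw : forall w, 0 <= w -> ex_derive (fun v => X (zeta v)) w)
    by (intros w Hw; eexists; apply HX, Hw).
  assert (EX1w : forall w, 0 <= w -> ex_derive (fun v => X1 (zeta v)) w)
    by (intros w Hw; eexists; apply HX1, Hw).
  assert (EYw : forall w, 0 <= w -> ex_derive (fun v => Y (zeta v)) w)
    by (intros w Hw; eexists; apply HY, Hw).
  assert (EY1w : forall w, 0 <= w -> ex_derive (fun v => Y1 (zeta v)) w)
    by (intros w Hw; eexists; apply HY1, Hw).
  assert (EX2w : forall w, 0 <= w -> ex_derive (fun v => X2 (zeta v)) w).
  { intros w Hw. apply (ex_derive_comp X2 zeta); [apply DX2, zeta_bounds, Hw|].
    unfold zeta. auto_derive. lra. }
  assert (EY2w : forall w, 0 <= w -> ex_derive (fun v => Y2 (zeta v)) w).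
  { intros w Hw. apply (ex_derive_comp Y2 zeta); [apply DY2, zeta_bounds, Hw|].
    unfold zeta. auto_derive. lra. }
  assert (HD : forall (h : R -> R) w l, is_derive h w l -> Derive (fun v : R => h v) w = l)
    by (intros; apply is_derive_unique; assumption).
  assert (D1a : forall w, 0 <= w -> is_derive prof1a w (prof2a w)).
  (* The compositions with [zeta] are named so that [auto_derive] treats each as one function with a
     known derivative. *)
  { intros w Hw. set (Xz := fun v => X (zeta v)) in *. set (X1z := fun v => X1 (zeta v)) in *.
    set (Yz := fun v => Y (zeta v)) in *.
    change prof1a with (fun w => (- 1 / 2 * Xz w + M * Yz w) / (1 + w) + X1z w / (1 + w) ^ 2).
    auto_derive.
    - repeat split; auto; try (apply Rgt_not_eq; nra); lra.
    - rewrite (HD Xz _ _ (HX w Hw)), (HD Yz _ _ (HY w Hw)), (HD X1z _ _ (HX1 w Hw)).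
      unfold prof2a, Xz, Yz, X1z. field. lra. }
  assert (D1b : forall w, 0 <= w -> is_derive prof1b w (prof2b w)).
  { intros w Hw. set (Xz := fun v => X (zeta v)) in *. set (Y1z := fun v => Y1 (zeta v)) in *.
    set (Yz := fun v => Y (zeta v)) in *.
    change prof1b with (fun w => (- 1 / 2 * Yz w - M * Xz w) / (1 + w) + Y1z w / (1 + w) ^ 2).
    auto_derive.
    - repeat split; auto; try (apply Rgt_not_eq; nra); lra.
    - rewrite (HD Xz _ _ (HX w Hw)), (HD Yz _ _ (HY w Hw)), (HD Y1z _ _ (HY1 w Hw)).
      unfold prof2b, Xz, Yz, Y1z. field. lra. }
  assert (E2a : forall w, 0 <= w -> ex_derive prof2a w).
  { intros w Hw. set (Xz := fun v => X (zeta v)) in *. set (X1z := fun v => X1 (zeta v)) in *.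
    set (X2z := fun v => X2 (zeta v)) in *.
    set (Yz := fun v => Y (zeta v)) in *. set (Y1z := fun v => Y1 (zeta v)) in *.
    change prof2a with (fun w => (- 1 / 2 * X1z w + M * Y1z w) / (1 + w) ^ 3
      - (- 1 / 2 * Xz w + M * Yz w) / (1 + w) ^ 2
      + X2z w / (1 + w) ^ 4 - 2 * X1z w / (1 + w) ^ 3).
    assert (0 < (1 + w) ^ 2) by (apply pow_lt; lra).
    assert (0 < (1 + w) ^ 3) by (apply pow_lt; lra).
    assert (0 < (1 + w) ^ 4) by (apply pow_lt; lra).
    auto_derive. repeat split; auto; apply Rgt_not_eq; assumption. }
  assert (E2b : forall w, 0 <= w -> ex_derive prof2b w).
  { intros w Hw. set (Xz := fun v => X (zeta v)) in *. set (X1z := fun v => X1 (zeta v)) in *.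
    set (Y2z := fun v => Y2 (zeta v)) in *.
    set (Yz := fun v => Y (zeta v)) in *. set (Y1z := fun v => Y1 (zeta v)) in *.
    change prof2b with (fun w => (- 1 / 2 * Y1z w - M * X1z w) / (1 + w) ^ 3
      - (- 1 / 2 * Yz w - M * Xz w) / (1 + w) ^ 2
      + Y2z w / (1 + w) ^ 4 - 2 * Y1z w / (1 + w) ^ 3).
    assert (0 < (1 + w) ^ 2) by (apply pow_lt; lra).
    assert (0 < (1 + w) ^ 3) by (apply pow_lt; lra).
    assert (0 < (1 + w) ^ 4) by (apply pow_lt; lra).
    auto_derive. repeat split; auto; apply Rgt_not_eq; assumption. }
  split; intros w Hw.
  - exact (is_derive_rot (fun v => X (zeta v)) (fun v => Y (zeta v)) w _ _ Hw (HX w Hw) (HY w Hw)).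
  - apply (is_derive_rot prof1a prof1b w (prof2a w) (prof2b w)); auto.
  - assert (Ea : ex_derive prof1a w) by (eexists; apply D1a, Hw).
    assert (Eb : ex_derive prof1b w) by (eexists; apply D1b, Hw).
    pose proof (E2a w Hw) as Ea2. pose proof (E2b w Hw) as Eb2.
    (* Continuity comes from differentiability, which uses that of [X2] and [Y2]. *)
    apply (ex_derive_continuous prof2). eexists.
    apply (is_derive_rot (fun v => (- 1 / 2 * prof1a v + M * prof1b v) / (1 + v) + prof2a v)
      (fun v => (- 1 / 2 * prof1b v - M * prof1a v) / (1 + v) + prof2b v)); [exact Hw | |];
    apply Derive_correct; auto_derive; repeat split; auto; lra.
  - pose proof (EX _ (zeta_bounds w Hw)) as E1. pose proof (EY _ (zeta_bounds w Hw)) as E2.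
    unfold prof, prof1, prof2, rot, prof2a, prof2b, prof1a, prof1b.
    set (e := exp _). set (cs := cos _). set (sn := sin _).
    set (x := X (zeta w)) in *. set (x1 := X1 (zeta w)) in *. set (x2 := X2 (zeta w)) in *.
    set (y := Y (zeta w)) in *. set (y1 := Y1 (zeta w)) in *. set (y2 := Y2 (zeta w)) in *.
    unfold zeta in E1, E2.
    (* As [1 - zeta = 1 / (1 + w)], the profile equation is the real part of [(1 + w)^(-3/2 - i M)]
       times Gauss's equation at [zeta]; [e / (1 + w)] is the modulus of that factor. *)
    match type of E1 with ?l = 0 => match type of E2 with ?r = 0 =>
      transitivity (e / (1 + w) * (cs * l + sn * r)) end end.
    + field. lra.
    + rewrite E1, E2. ring.
Qed.

End ProfileOfSystem.

(** * The hypergeometric series *)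

(** The recurrence is the real part of [(n + 1)^2 a_{n+1} = (n + 1/2 + i M)^2 a_n] for
    [a = c + i d]; it makes the coefficient of each [z^n] cancel. *)
Lemma PSeries_ode (M : R) (c d : nat -> R) (z : R) :
  (forall n, (INR n + 1) ^ 2 * c (S n) =
     ((INR n + 1 / 2) ^ 2 - M ^ 2) * c n - 2 * M * (INR n + 1 / 2) * d n) ->
  Rbar_lt (Rabs z) (CV_radius c) -> Rbar_lt (Rabs z) (CV_radius d) ->
  z * (1 - z) * PSeries (PS_derive (PS_derive c)) z
    + (1 - 2 * z) * PSeries (PS_derive c) z + 2 * M * z * PSeries (PS_derive d) z
    - (1 / 4 - M ^ 2) * PSeries c z + M * PSeries d z = 0.
Proof.
  intros Hrec Hc Hd.
  assert (Hc1 : Rbar_lt (Rabs z) (CV_radius (PS_derive c))) by (rewrite CV_radius_derive; exact Hc).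
  assert (Hc2 : Rbar_lt (Rabs z) (CV_radius (PS_derive (PS_derive c))))
    by (rewrite CV_radius_derive; exact Hc1).
  assert (Hd1 : Rbar_lt (Rabs z) (CV_radius (PS_derive d))) by (rewrite CV_radius_derive; exact Hd).
  assert (P0 := PSeries_correct _ _ (CV_radius_inside c z Hc)).
  assert (P1 := PSeries_correct _ _ (CV_radius_inside _ z Hc1)).
  assert (P2 := PSeries_correct _ _ (CV_radius_inside _ z Hc2)).
  assert (Q0 := PSeries_correct _ _ (CV_radius_inside d z Hd)).
  assert (Q1 := PSeries_correct _ _ (CV_radius_inside _ z Hd1)).
  assert (comm : forall a b : R, mult (K := R_AbsRing) a b = mult b a) by (intros; apply Rmult_comm).
  assert (sc : forall (a : nat -> R) k l, is_pseries a z l ->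
     is_pseries (fun n => k * a n) z (k * l)).
  { intros a k l H. apply (is_pseries_scal (V := R_NormedModule) k a z l); auto. }
  assert (pl : forall (a b : nat -> R) l m, is_pseries a z l -> is_pseries b z m ->
     is_pseries (fun n => a n + b n) z (l + m)).
  { intros a b l m H1 H2. apply (is_pseries_plus (V := R_NormedModule) a b z l m); auto. }
  assert (inc : forall (a : nat -> R) l, is_pseries a z l -> is_pseries (PS_incr_1 a) z (z * l)).
  { intros a l H. apply (is_pseries_incr_1 (V := R_NormedModule) a z l); auto. }
  pose proof (pl _ _ _ _ (inc _ _ P2) (pl _ _ _ _ (sc _ (-1) _ (inc _ _ (inc _ _ P2)))
    (pl _ _ _ _ P1 (pl _ _ _ _ (sc _ (-2) _ (inc _ _ P1)) (pl _ _ _ _ (sc _ (2 * M) _ (inc _ _ Q1))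
    (pl _ _ _ _ (sc _ (- (1 / 4 - M ^ 2)) _ P0) (sc _ M _ Q0))))))) as H.
  apply is_pseries_unique in H.
  rewrite (PSeries_ext _ (fun _ => 0)), PSeries_const_0 in H.
  - rewrite H. ring.
  - intros n. unfold PS_incr_1, PS_derive.
    (* The double shift by [z^2] has the default coefficient [0] at [n = 0] and [n = 1], which are
       therefore separate cases. *)
    destruct n as [|n].
    + pose proof (Hrec 0%nat) as E. simpl in *. unfold zero; simpl. lra.
    + pose proof (Hrec (S n)) as E. destruct n as [|n].
      * simpl in *. unfold zero; simpl. nra.
      * set (N := INR (S (S n))) in *.
        replace (INR (S (S (S n)))) with (N + 1) by (unfold N; rewrite <- S_INR; reflexivity).
        replace (INR (S n)) with (N - 1) by (unfold N; rewrite (S_INR (S n)); ring).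
        nra.
Qed.

(** The Taylor coefficients [((a)_n / n!)^2] with [a = 1/2 + i M], given through their ratio, the
    form used by the recurrences and the ratio test. *)
Fixpoint coef (M : R) (n : nat) : C :=
  match n with
  | O => RtoC 1
  | S k => (coef M k * ((half + iC M + RtoC (INR k)) * (half + iC M + RtoC (INR k)))
             * RtoC (/ (INR k + 1) ^ 2))%C
  end.

Lemma pochhammer_1 n : pochhammer (RtoC 1) n = RtoC (INR (fact n)).
Proof.
  induction n as [|n IH]; [reflexivity|].
  change (pochhammer (RtoC 1) (S n)) with (pochhammer (RtoC 1) n * (RtoC 1 + RtoC (INR n)))%C.
  rewrite IH, <- RtoC_plus, <- RtoC_mult. f_equal.
  rewrite fact_simpl, mult_INR, S_INR. ring.
Qed.

Lemma hyp_term_coef M z n :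
  hyp_term (half + iC M) (half + iC M) (RtoC 1) (RtoC z) n = (coef M n * RtoC (z ^ n))%C.
Proof.
  unfold hyp_term. rewrite pochhammer_1, RtoC_pow. f_equal.
  induction n as [|n IH].
  - simpl. field.
  - change (coef M (S n)) with (coef M n * ((half + iC M + RtoC (INR n))
      * (half + iC M + RtoC (INR n))) * RtoC (/ (INR n + 1) ^ 2))%C.
    rewrite <- IH.
    change (pochhammer (half + iC M) (S n)) with
      (pochhammer (half + iC M) n * (half + iC M + RtoC (INR n)))%C.
    rewrite fact_simpl, mult_INR, S_INR.
    assert (Hn : INR n + 1 <> 0) by (rewrite <- S_INR; apply not_0_INR; lia).
    assert (Hf : INR (fact n) <> 0) by apply INR_fact_neq_0.
    rewrite RtoC_inv, RtoC_pow by (apply pow_nonzero; exact Hn).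
    rewrite RtoC_mult.
    assert (Hn' : RtoC (INR n + 1) <> RtoC 0) by (intros E; apply Hn, RtoC_inj, E).
    assert (Hf' : RtoC (INR (fact n)) <> RtoC 0) by (intros E; apply Hf, RtoC_inj, E).
    field. split; assumption.
Qed.

Definition coef_re (M : R) (n : nat) : R := Re (coef M n).
Definition coef_im (M : R) (n : nat) : R := Im (coef M n).

Lemma coef_re_rec M n : (INR n + 1) ^ 2 * coef_re M (S n) =
  ((INR n + 1 / 2) ^ 2 - M ^ 2) * coef_re M n - 2 * M * (INR n + 1 / 2) * coef_im M n.
Proof.
  assert (Hn : INR n + 1 <> 0) by (rewrite <- S_INR; apply not_0_INR; lia).
  unfold coef_re, coef_im. cbn [coef]. unfold half, iC, Ci.
  destruct (coef M n) as [a b]. unfold Re, Im, Cmult, Cplus, RtoC; cbn [fst snd].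
  field. exact Hn.
Qed.

Lemma coef_im_rec M n : (INR n + 1) ^ 2 * coef_im M (S n) =
  ((INR n + 1 / 2) ^ 2 - M ^ 2) * coef_im M n + 2 * M * (INR n + 1 / 2) * coef_re M n.
Proof.
  assert (Hn : INR n + 1 <> 0) by (rewrite <- S_INR; apply not_0_INR; lia).
  unfold coef_re, coef_im. cbn [coef]. unfold half, iC, Ci.
  destruct (coef M n) as [a b]. unfold Re, Im, Cmult, Cplus, RtoC; cbn [fst snd].
  field. exact Hn.
Qed.

(** Because [a = b], the numerator of the ratio is a square, so its modulus is free of square
    roots. *)
Lemma Cmod_coef_S M n : Cmod (coef M (S n)) =
  Cmod (coef M n) * (((INR n + 1 / 2) ^ 2 + M ^ 2) / (INR n + 1) ^ 2).
Proof.
  assert (Hn : 0 < INR n + 1) by (pose proof (pos_INR n); lra).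
  cbn [coef]. rewrite !Cmod_mult, Cmod_R, Rabs_pos_eq
    by (apply Rlt_le, Rinv_0_lt_compat, pow_lt, Hn).
  rewrite Rmult_assoc. unfold Rdiv. f_equal. f_equal.
  unfold Cmod at 1 2. rewrite sqrt_sqrt.
  - unfold half, iC, Ci, Cmult, Cplus, RtoC; cbn [fst snd]. field.
  - apply Rplus_le_le_0_compat; apply pow2_ge_0.
Qed.

Lemma Cmod_coef_pos M n : 0 < Cmod (coef M n).
Proof.
  induction n as [|n IH].
  - cbn [coef]. rewrite Cmod_R, Rabs_R1. lra.
  - rewrite Cmod_coef_S. pose proof (pos_INR n).
    apply Rmult_lt_0_compat; [exact IH|]. apply Rdiv_lt_0_compat; [nra | apply pow_lt; lra].
Qed.

(** The ratio test needs nonzero coefficients, and real or imaginary parts can vanish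
    ([coef_im M 0 = 0]); so it is applied to the moduli, which dominate both. *)
Lemma CV_radius_Cmod_coef M : CV_radius (fun n => Cmod (coef M n)) = Finite 1.
Proof.
  rewrite <- Rinv_1. apply CV_radius_finite_DAlembert.
  - intros n. apply Rgt_not_eq, Cmod_coef_pos.
  - lra.
  - set (h := fun v => (1 - v / 2) ^ 2 + M ^ 2 * v ^ 2).
    apply is_lim_seq_ext with (fun n => h (/ (INR n + 1))).
    + intros n. rewrite Cmod_coef_S. pose proof (Cmod_coef_pos M n). pose proof (pos_INR n).
      rewrite Rabs_pos_eq.
      * unfold h. field. split; lra.
      * apply Rlt_le, Rdiv_lt_0_compat; [|assumption].
        apply Rmult_lt_0_compat; [assumption|].
        apply Rdiv_lt_0_compat; [nra | apply pow_lt; lra].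
    + replace (Finite 1) with (Finite (h 0)) by (unfold h; f_equal; field).
      apply (is_lim_seq_continuous h).
      * apply continuity_pt_filterlim. apply (ex_derive_continuous (V := R_NormedModule) h).
        unfold h. auto_derive. auto.
      * apply is_lim_seq_ext with (fun n => / INR (S n)); [intros n; rewrite S_INR; reflexivity|].
        apply (is_lim_seq_incr_1 (fun n => / INR n)).
        apply (is_lim_seq_inv INR p_infty); [apply is_lim_seq_INR | discriminate].
Qed.

(** The radius is the supremum of the [r] for which the terms stay bounded, and boundedness passes
    from [A] to [a]. *)
Lemma CV_radius_dominated (a A : nat -> R) :
  (forall n, Rabs (a n) <= A n) -> Rbar_le (CV_radius A) (CV_radius a).
Proof.
  intros H. destruct (CV_radius_bounded A) as [_ HA]. destruct (CV_radius_bounded a) as [Ha _].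
  apply HA. intros r [K HK]. apply Ha. exists K. intros n.
  eapply Rle_trans; [|apply (HK n)]. rewrite !Rabs_mult.
  apply Rmult_le_compat_r; [apply Rabs_pos|].
  eapply Rle_trans; [apply H | apply Rle_abs].
Qed.

Lemma coef_re_radius M z : 0 <= z < 1 -> Rbar_lt (Rabs z) (CV_radius (coef_re M)).
Proof.
  intros Hz. apply Rbar_lt_le_trans with (Finite 1).
  - simpl. rewrite Rabs_pos_eq; lra.
  - rewrite <- (CV_radius_Cmod_coef M). apply CV_radius_dominated. intros n. apply re_le_Cmod.
Qed.

Lemma coef_im_radius M z : 0 <= z < 1 -> Rbar_lt (Rabs z) (CV_radius (coef_im M)).
Proof.
  intros Hz. apply Rbar_lt_le_trans with (Finite 1).
  - simpl. rewrite Rabs_pos_eq; lra.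
  - rewrite <- (CV_radius_Cmod_coef M). apply CV_radius_dominated. intros n.
    unfold coef_im, Cmod.
    rewrite <- sqrt_Rsqr_abs. apply sqrt_le_1_alt. unfold Rsqr, Im. nra.
Qed.

(** * The real and imaginary profiles of the kernel *)

(** The hypotheses are invariant under [(c, d) -> (d, -c)], multiplication by [- i], so both
    [kernel_re] and [kernel_im] are covered. *)
Lemma profile_of_pseries M (c d : nat -> R) :
  (forall n, (INR n + 1) ^ 2 * c (S n) =
     ((INR n + 1 / 2) ^ 2 - M ^ 2) * c n - 2 * M * (INR n + 1 / 2) * d n) ->
  (forall n, (INR n + 1) ^ 2 * d (S n) =
     ((INR n + 1 / 2) ^ 2 - M ^ 2) * d n + 2 * M * (INR n + 1 / 2) * c n) ->
  (forall z, 0 <= z < 1 -> Rbar_lt (Rabs z) (CV_radius c)) ->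
  (forall z, 0 <= z < 1 -> Rbar_lt (Rabs z) (CV_radius d)) ->
  exists P' P'', profile M (prof M (PSeries c) (PSeries d)) P' P''.
Proof.
  intros Hc Hd Rc Rd.
  eexists. eexists.
  apply (profile_prof M _ (PSeries (PS_derive c)) (PSeries (PS_derive (PS_derive c)))
    _ (PSeries (PS_derive d)) (PSeries (PS_derive (PS_derive d)))); intros z Hz.
  - apply is_derive_PSeries; auto.
  - apply is_derive_PSeries; rewrite CV_radius_derive; auto.
  - eexists. apply is_derive_PSeries; rewrite !CV_radius_derive; auto.
  - apply is_derive_PSeries; auto.
  - apply is_derive_PSeries; rewrite CV_radius_derive; auto.
  - eexists. apply is_derive_PSeries; rewrite !CV_radius_derive; auto.
  - apply PSeries_ode; auto.
  (* The imaginary part of the equation is its real part for the pair [(d, -c)]. *)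
  - pose proof (PSeries_ode M d (fun n => - c n) z) as H.
    replace (PSeries (PS_derive (fun n => - c n)) z) with (- PSeries (PS_derive c) z) in H.
    + replace (PSeries (fun n => - c n) z) with (- PSeries c z) in H
        by (symmetry; apply PSeries_opp).
      rewrite <- H; auto; [ring | intros n; rewrite Hd; ring|].
      change (CV_radius (fun n => - c n)) with (CV_radius (PS_opp c)).
      rewrite CV_radius_opp. auto.
    + rewrite <- PSeries_opp. apply PSeries_ext. intros n.
      unfold PS_opp, PS_derive, opp; simpl. ring.
Qed.

Definition hyp_re (M : R) : R -> R := PSeries (coef_re M).
Definition hyp_im (M : R) : R -> R := PSeries (coef_im M).

Lemma hypergeom_real M z :
  hypergeom (half + iC M) (half + iC M) (RtoC 1) (RtoC z) = (hyp_re M z, hyp_im M z).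
Proof.
  unfold hypergeom, hyp_re, hyp_im, PSeries.
  f_equal; apply Series_ext; intros n; rewrite hyp_term_coef;
    [apply re_scal_r | apply im_scal_r].
Qed.

Definition kernel_re (M : R) : R -> R := prof M (hyp_re M) (hyp_im M).
(* [Im z = Re (- i z)], and [- i (X + i Y) = Y - i X]. *)
Definition kernel_im (M : R) : R -> R := prof M (hyp_im M) (fun z => - hyp_re M z).

Lemma profile_kernel_re M : exists P' P'', profile M (kernel_re M) P' P''.
Proof.
  apply profile_of_pseries.
  - apply coef_re_rec.
  - apply coef_im_rec.
  - apply coef_re_radius.
  - apply coef_im_radius.
Qed.

Lemma profile_ext M P Q P' P'' :
  (forall w, P w = Q w) -> profile M P P' P'' -> profile M Q P' P''.
Proof.
  intros E HP. destruct HP as [H1 H2 H3 H4]. split; auto.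
  - intros w Hw. apply is_derive_ext with P; auto.
  - intros w Hw. rewrite <- E. auto.
Qed.

Lemma profile_kernel_im M : exists P' P'', profile M (kernel_im M) P' P''.
Proof.
  destruct (profile_of_pseries M (coef_im M) (fun n => - coef_re M n)) as (P' & P'' & H).
  - intros n. rewrite coef_im_rec. ring.
  - intros n. transitivity (- ((INR n + 1) ^ 2 * coef_re M (S n))); [ring|].
    rewrite coef_re_rec. ring.
  - apply coef_im_radius.
  - intros z Hz. change (CV_radius (fun n => - coef_re M n)) with (CV_radius (PS_opp (coef_re M))).
    rewrite CV_radius_opp. apply coef_re_radius, Hz.
  - exists P', P''. refine (profile_ext M _ _ P' P'' _ H).
    intros w. unfold kernel_im, prof, hyp_im, hyp_re. f_equal.
    apply PSeries_opp.
Qed.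

Lemma hyp_at_0 M : hyp_re M 0 = 1 /\ hyp_im M 0 = 0.
Proof.
  unfold hyp_re, hyp_im. rewrite !PSeries_0. split; reflexivity.
Qed.

Lemma kernel_re_0 M : kernel_re M 0 = 1.
Proof.
  unfold kernel_re, prof, rot, zeta. replace (0 / (1 + 0)) with 0 by field.
  destruct (hyp_at_0 M) as [-> ->]. replace (1 + 0) with 1 by ring.
  rewrite ln_1. replace (M * 0) with 0 by ring.
  replace (- (0 / 2)) with 0 by field. rewrite exp_0, cos_0, sin_0. ring.
Qed.

Lemma kernel_im_0 M : kernel_im M 0 = 0.
Proof.
  unfold kernel_im, prof, rot, zeta. replace (0 / (1 + 0)) with 0 by field.
  destruct (hyp_at_0 M) as [-> ->]. replace (1 + 0) with 1 by ring.
  rewrite ln_1. replace (M * 0) with 0 by ring.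
  replace (- (0 / 2)) with 0 by field. rewrite exp_0, cos_0, sin_0. ring.
Qed.

(** * The kernel in light-cone coordinates *)

Lemma Cexp_plus (z w : C) : (Cexp z * Cexp w)%C = Cexp (z + w)%C.
Proof.
  unfold Cexp. destruct z as [a b], w as [c d].
  unfold Re, Im, Cmult, Cplus; cbn [fst snd].
  rewrite exp_plus, cos_plus, sin_plus. f_equal; ring.
Qed.

Lemma phi_eq t b : phi t b = 2 * exp (- ((b + t) / 2)) * sh (t - b).
Proof.
  unfold phi, sh.
  transitivity (exp (- ((b + t) / 2)) * exp ((t - b) / 2)
    - exp (- ((b + t) / 2)) * exp (- ((t - b) / 2))); [|field].
  rewrite <- !exp_plus. f_equal; f_equal; field.
Qed.

(** With [r = e^{-(b+t)/2}] the numerator is [4 r^2 w] and the denominator [4 r^2 (1 + w)]. In [(4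
    r^2)^{i M} (4 r^2 (1 + w))^{-1/2 - i M}] the oscillating powers of [2 r] cancel and [1 / (2 r)]
    remains; the Jacobian [phi = 2 r sh] turns it into [sh]. *)
Lemma kernel_formula M x t b s : -1 <= s <= 1 ->
  (RtoC (phi t b) * kernel M x t (x + phi t b * s) b)%C =
  (ker0 (kernel_re M) t b s, ker0 (kernel_im M) t b s).
Proof.
  intros Hs. unfold ker0. set (w := arg t b s).
  set (r := exp (- ((b + t) / 2))).
  assert (Hr : 0 < r) by apply exp_pos.
  assert (Hw : 0 <= w) by apply arg_nonneg.
  assert (Hrr : exp (- b - t) = r * r)
    by (unfold r; rewrite <- exp_plus; f_equal; field).
  assert (Hphi : phi t b = 2 * r * sh (t - b)) by apply phi_eq.
  assert (Hnum : (exp (- b) - exp (- t)) ^ 2 - (x - (x + phi t b * s)) ^ 2 = 4 * r ^ 2 * w).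
  { fold (phi t b). rewrite Hphi. unfold w, arg. rewrite cap_inside by exact Hs. ring. }
  assert (Hden : (exp (- b) + exp (- t)) ^ 2 - (x - (x + phi t b * s)) ^ 2 = (2 * r) ^ 2 * (1 + w)).
  { transitivity ((exp (- b) - exp (- t)) ^ 2 - (x - (x + phi t b * s)) ^ 2
      + 4 * (exp (- b) * exp (- t))); [ring|].
    rewrite Hnum, <- exp_plus. change (- b + - t) with (- b - t). rewrite Hrr. ring. }
  unfold kernel. cbv zeta. rewrite Hnum, Hden, Hrr.
  replace (4 * r ^ 2 * w / ((2 * r) ^ 2 * (1 + w))) with (zeta w)
    by (unfold zeta; field; lra).
  rewrite hypergeom_real. unfold cpower. rewrite Cexp_plus.
  replace (4 * (r * r)) with ((2 * r) ^ 2) by ring.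
  assert (Hl : ln ((2 * r) ^ 2 * (1 + w)) = ln ((2 * r) ^ 2) + ln (1 + w))
    by (apply ln_mult; [apply pow_lt; lra | lra]).
  assert (Hl2 : ln ((2 * r) ^ 2) = 2 * ln (2 * r)).
  { replace ((2 * r) ^ 2) with (2 * r * (2 * r)) by ring. rewrite ln_mult by lra. ring. }
  rewrite Hl, Hl2.
  set (l := ln (2 * r)). set (L := ln (1 + w)).
  replace (iC M * RtoC (2 * l) + (- half - iC M) * RtoC (2 * l + L))%C
    with ((- l + - (L / 2), - (M * L)) : C).
  2: { unfold iC, half, Ci, Cmult, Cplus, Cminus, Copp, Cplus, RtoC; cbn [fst snd].
       f_equal; field. }
  unfold Cexp, Re, Im; cbn [fst snd].
  rewrite exp_plus, cos_neg, sin_neg.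
  assert (El : exp (- l) = / (2 * r))
    by (rewrite exp_Ropp; unfold l; rewrite exp_ln by lra; reflexivity).
  rewrite El, Hphi.
  unfold kernel_re, kernel_im, prof, rot. fold L.
  unfold Cmult, RtoC; cbn [fst snd].
  f_equal; field; lra.
Qed.

(** * The source solution as a combination of Duhamel integrals *)

Section SourceSolution.

Variables (M : R) (f : R -> R -> C) (g1 g2 : R -> R -> R).
Hypotheses (Hg1 : cont2 g1) (Hg2 : cont2 g2)
  (Hf : forall y b, 0 <= b -> f y b = (g1 y b, g2 y b)).

Let K1 := ker0 (kernel_re M).
Let K2 := ker0 (kernel_im M).

Let HK1 : cont3 K1.
Proof. destruct (profile_kernel_re M) as (P' & P'' & H). exact (cont3_ker0 _ _ _ _ H). Qed.

Let HK2 : cont3 K2.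
Proof. destruct (profile_kernel_im M) as (P' & P'' & H). exact (cont3_ker0 _ _ _ _ H). Qed.

(** Integrability of [k] is part of the conclusion: continuity is known for [phi * kernel] in the
    rescaled variable, not for the kernel itself. *)
Lemma is_RInt_rescale (h k : R -> R) (x p l : R) : 0 < p ->
  is_RInt h (-1) 1 l ->
  (forall s, -1 < s < 1 -> h s = p * k (x + p * s)) ->
  is_RInt k (x - p) (x + p) l.
Proof.
  intros Hp Hh Hk.
  apply (is_RInt_ext (fun y => scal (/ p) (h (/ p * y + - (x / p))))).
  - rewrite Rmin_left, Rmax_right by lra. intros y Hy.
    rewrite Hk.
    + replace (x + p * (/ p * y + - (x / p))) with y by (field; lra).
      unfold scal; simpl; unfold mult; simpl. field. lra.
    + replace (/ p * y + - (x / p)) with ((y - x) / p) by (field; lra).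
      split; apply Rmult_lt_reg_r with p; try exact Hp; unfold Rdiv;
        rewrite Rmult_assoc, Rinv_l by lra; lra.
  - apply (is_RInt_comp_lin (V := R_NormedModule) h).
    replace (/ p * (x - p) + - (x / p)) with (-1) by (field; lra).
    replace (/ p * (x + p) + - (x / p)) with 1 by (field; lra).
    exact Hh.
Qed.

Lemma inner_integral x t b : 0 <= b < t ->
  RInt (V := C_R_CompleteNormedModule) (fun y => (f y b * kernel M x t y b)%C)
    (x - (exp (- b) - exp (- t))) (x + exp (- b) - exp (- t)) =
  (slice g1 K1 x t b - slice g2 K2 x t b, slice g1 K2 x t b + slice g2 K1 x t b).
Proof.
  intros Hb.
  assert (Hp : 0 < phi t b) by (unfold phi; apply Rlt_0_minus, exp_increasing; lra).
  replace (x + exp (- b) - exp (- t)) with (x + phi t b) by (unfold phi; ring).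
  fold (phi t b).
  apply (is_RInt_unique (V := C_R_CompleteNormedModule)).
  apply (is_RInt_fct_extend_pair (U := R_NormedModule) (V := R_NormedModule));
  refine (is_RInt_rescale _ _ x (phi t b) _ Hp _ _).
  1: apply is_RInt_minus_R;
      apply (RInt_correct (V := R_CompleteNormedModule)), slice_ex_RInt; assumption.
  2: apply is_RInt_plus_R;
      apply (RInt_correct (V := R_CompleteNormedModule)), slice_ex_RInt; assumption.
  all: intros s Hs; pose proof (kernel_formula M x t b s ltac:(lra)) as HK;
    rewrite Hf by lra; fold K1 K2 in HK;
    unfold K1, K2 in *; destruct (kernel M x t (x + phi t b * s) b) as [k1 k2];
    unfold Cmult, RtoC in HK; cbn [fst snd] in HK;
    injection HK as E1 E2; rewrite <- E1, <- E2;
    unfold Cmult; cbn [fst snd]; ring.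
Qed.

Lemma source_solution_duhamel x t : 0 <= t ->
  source_solution M f x t =
  (duhamel g1 K1 x t - duhamel g2 K2 x t, duhamel g1 K2 x t + duhamel g2 K1 x t).
Proof.
  intros Ht. unfold source_solution.
  pose proof (slice_cont g1 K1 Hg1 HK1) as C11.
  pose proof (slice_cont g1 K2 Hg1 HK2) as C12.
  pose proof (slice_cont g2 K1 Hg2 HK1) as C21.
  pose proof (slice_cont g2 K2 Hg2 HK2) as C22.
  rewrite (RInt_ext (V := C_R_CompleteNormedModule) _
    (fun b => (slice g1 K1 x t b - slice g2 K2 x t b, slice g1 K2 x t b + slice g2 K1 x t b))).
  - apply (is_RInt_unique (V := C_R_CompleteNormedModule)).
    apply (is_RInt_fct_extend_pair (U := R_NormedModule) (V := R_NormedModule)); cbn [fst snd].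
    + apply is_RInt_minus_R;
      apply (RInt_correct (V := R_CompleteNormedModule)), ex_RInt_cont; cont_tac.
    + apply is_RInt_plus_R;
      apply (RInt_correct (V := R_CompleteNormedModule)), ex_RInt_cont; cont_tac.
  (* Only [0 < b < t] has to be compared, so the degenerate cone [b = t], where [phi = 0], is never
     met. *)
  - rewrite Rmin_left, Rmax_right by exact Ht. intros b Hb. apply inner_integral. lra.
Qed.

End SourceSolution.

(** * Passage to complex values *)

(* [h x t = h 0 t + x * int_0^1 h' (r x) t dr] *)
Lemma cont2_of_derive (h h' : R -> R -> R) :
  (forall x t, is_derive (fun z => h z t) x (h' x t)) ->
  cont2 h' -> (forall x, cont (h x)) -> cont2 h.
Proof.
  intros Dh Hh' Hh.
  assert (H0 : cont (fun p : R * R => h 0 (snd p))) by apply (cont_snd (h 0)), Hh.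
  apply (cont_ext (fun p : R * R =>
    h 0 (snd p) + RInt (fun r => fst p * h' (fst p * r) (snd p)) 0 1)).
  - intros [x t]; cbn [fst snd].
    assert (HI : is_RInt (fun r => h' (fst (x, t) * r) t * fst (x, t)) 0 1 (h x t - h 0 t)).
    { cbn [fst]. evar_last.
      - apply (is_RInt_derive (V := R_CompleteNormedModule) (fun r => h (x * r) t)).
        + intros r _. apply is_derive_comp_R with (h := fun z => h z t) (k := fun r => x * r).
          * apply Dh.
          * auto_derive; [auto | ring].
        + intros r _. revert r. refine (_ : cont (fun r => h' (x * r) t * x)). cont_tac.
      - rewrite Rmult_1_r, Rmult_0_r. reflexivity. }
    rewrite (is_RInt_unique (V := R_CompleteNormedModule) _ 0 1 (h x t - h 0 t)); [ring|].
    revert HI. apply is_RInt_ext. intros r _. apply Rmult_comm.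
  - apply cont_plus; [exact H0|].
    apply (cont_RInt (fun (p : R * R) r => fst p * h' (fst p * r) (snd p))); [lra|].
    cont_tac.
Qed.

Section Components.

(* [p] is instantiated with the real and the imaginary part. *)
Variable p : C -> R.
Hypothesis Hp : is_linear (U := C_R_NormedModule) (V := R_NormedModule) p.

(* Reflection in time gives global functions of [t], continuous and differentiable in [x]. *)
Definition reflect (h : R -> R -> C) (x t : R) : R := p (h x (Rabs t)).

(** This converts limits relative to the half-line into two-sided limits of reflected functions. *)
Lemma within_Rabs t :
  filterlim Rabs (locally t) (within (fun s => 0 <= s) (locally (Rabs t))).
Proof.
  intros Q HQ. apply (continuous_Rabs t) in HQ. unfold filtermap in *.
  refine (filter_imp _ _ _ HQ). intros s Hs. apply Hs, Rabs_pos.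
Qed.

Lemma cont2_reflect (h : R -> R -> C) : continuous_half h -> cont2 (reflect h).
Proof.
  intros Hh [x t]. unfold reflect; cbn [fst snd].
  apply (filterlim_comp _ _ _ (fun q : R * R => h (fst q) (Rabs (snd q))) p
    _ (locally (T := C_R_NormedModule) (h x (Rabs t)))).
  - refine (filterlim_comp _ _ _ (fun q : R * R => (fst q, Rabs (snd q)))
      (fun q => h (fst q) (snd q)) _ _ _ _ (Hh (x, Rabs t) (Rabs_pos t))).
    intros Q HQ. unfold within in HQ.
    assert (HC : continuous (U := prod_UniformSpace R_UniformSpace R_UniformSpace)
      (fun q : R * R => (fst q, Rabs (snd q))) (x, t)).
    { apply continuous_pair; [apply continuous_fst|].
      apply (continuous_comp snd Rabs); [apply continuous_snd | apply continuous_Rabs]. }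
    apply HC in HQ. unfold filtermap in *.
    refine (filter_imp _ _ _ HQ). intros q Hq. apply Hq. cbn [snd]. apply Rabs_pos.
  - apply (linear_cont (U := C_R_NormedModule) (V := R_NormedModule) p), Hp.
Qed.

Lemma is_derive_reflect (h h' : R -> R -> C) : is_partial_x h h' ->
  forall x t, is_derive (fun z => reflect h z t) x (reflect h' x t).
Proof.
  intros Hh x t. unfold reflect.
  pose proof (filterdiff_comp (U := R_NormedModule) (V := C_R_NormedModule) (W := R_NormedModule)
    (fun y => h y (Rabs t)) p _ p (Hh x (Rabs t) (Rabs_pos t))
    (filterdiff_linear (U := C_R_NormedModule) (V := R_NormedModule) p Hp)) as H.
  refine (filterdiff_ext_lin _ _ _ H _).
  intros y. apply (linear_scal (U := C_R_NormedModule) (V := R_NormedModule) p Hp).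
Qed.

Lemma filter_lim_within t : 0 <= t -> is_filter_lim (within (fun s => 0 <= s) (locally t)) t.
Proof.
  intros Ht Q HQ. unfold within. refine (filter_imp _ _ _ HQ). auto.
Qed.

Lemma cont_reflect_time (h h' : R -> R -> C) : is_partial_t h h' ->
  forall x, cont (reflect h x).
Proof.
  intros Hh x t. unfold reflect.
  refine (filterlim_comp _ _ _ (fun s => h x (Rabs s)) p _
    (locally (T := C_R_NormedModule) (h x (Rabs t))) _ _ _).
  - refine (filterlim_comp _ _ _ Rabs (h x) _ _ _ (within_Rabs t) _).
    refine (filterdiff_continuous_aux (V := C_R_NormedModule) (h x) _ (Rabs t) _).
    + eexists. apply (Hh x (Rabs t) (Rabs_pos t)).
    + apply filter_lim_within, Rabs_pos.
  - apply (linear_cont (U := C_R_NormedModule) (V := R_NormedModule) p), Hp.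
Qed.

Lemma reflect_regularity (h : R -> R -> C) : continuous_with_second_derivatives h ->
  exists g1 g2, cont2 (reflect h) /\ cont2 g1 /\ cont2 g2 /\
    (forall x b, is_derive (fun z => reflect h z b) x (g1 x b)) /\
    (forall x b, is_derive (fun z => g1 z b) x (g2 x b)).
Proof.
  intros (hx & ht & hxx & hxt & htx & htt & [Px _ Pxx Pxt _ _] & Ch & Cxx & _).
  exists (reflect hx), (reflect hxx).
  pose proof (cont2_reflect _ Ch). pose proof (cont2_reflect _ Cxx).
  pose proof (is_derive_reflect _ _ Px). pose proof (is_derive_reflect _ _ Pxx).
  repeat (split; [assumption|]). split; [|split; [|split]]; try assumption.
  (* Joint continuity of [hx] is not among the data; it follows from that of [hxx] together with
     continuity of [hx] in [t], which the existence of [hxt] gives. *)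
  apply cont2_of_derive with (reflect hxx); try assumption.
  apply (cont_reflect_time _ _ Pxt).
Qed.

End Components.

Lemma is_derive_pair (v1 v2 : R -> R) (x l1 l2 : R) :
  is_derive v1 x l1 -> is_derive v2 x l2 ->
  is_derive (V := C_R_NormedModule) (fun y => (v1 y, v2 y)) x (l1, l2).
Proof.
  intros H1 H2.
  exact (filterdiff_comp_2 (U := R_NormedModule) (V := R_NormedModule) (W := C_R_NormedModule)
    v1 v2 (fun a b => (a, b)) _ _ (fun a b => (a, b)) H1 H2
    (filterdiff_linear _ (is_linear_prod _ _ is_linear_fst is_linear_snd))).
Qed.

Lemma within_nonneg_proper t : 0 <= t ->
  ProperFilter' (within (fun s => 0 <= s) (locally t)).
Proof.
  intros Ht. constructor; [|apply within_filter, locally_filter].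
  intros H. apply (locally_singleton t _ H), Ht.
Qed.

Lemma is_derive_time_pair (v : R -> C) (v1 v2 : R -> R) (t l1 l2 : R) : 0 <= t ->
  is_derive v1 t l1 -> is_derive v2 t l2 ->
  (forall s, 0 <= s -> v s = (v1 s, v2 s)) ->
  is_derive_time v t (l1, l2).
Proof.
  intros Ht H1 H2 Hv.
  destruct (is_derive_pair v1 v2 t l1 l2 H1 H2) as [Hl Hd].
  split; [exact Hl|]. intros x Hx.
  pose proof (within_nonneg_proper t Ht).
  (* [filterdiff] quantifies over all limit points of the filter; properness of the half-line filter
     leaves only [t]. *)
  assert (E : t = x) by (apply (is_filter_lim_unique t x (filter_lim_within t Ht) Hx)).
  subst x. intros eps.
  assert (Ht' : is_filter_lim (locally t) t) by (intros Q HQ; exact HQ).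
  generalize (Hd t Ht' eps). unfold within. apply filter_imp.
  intros s Hs Hs0. rewrite (Hv s Hs0), (Hv t Ht). exact Hs.
Qed.

Lemma continuous_half_pair (h : R -> R -> C) (h1 h2 : R -> R -> R) :
  cont2 h1 -> cont2 h2 -> (forall x t, 0 <= t -> h x t = (h1 x t, h2 x t)) ->
  continuous_half h.
Proof.
  intros H1 H2 Hh [x t] Ht. cbn [fst snd] in *. rewrite (Hh x t Ht).
  assert (HC : continuous (U := C_R_NormedModule)
    (fun q : R * R => ((h1 (fst q) (snd q), h2 (fst q) (snd q)) : C)) (x, t)).
  { apply (continuous_pair (V := R_UniformSpace) (W := R_UniformSpace));
      [apply (H1 (x, t)) | apply (H2 (x, t))]. }
  intros Q HQ. apply HC in HQ. unfold filtermap, within in *.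
  refine (filter_imp _ _ _ HQ). intros q Hq Hq0. rewrite Hh by exact Hq0. exact Hq.
Qed.

Lemma is_C2_solution_pair M (f u : R -> R -> C) (F1 F2 u1 u2 : R -> R -> R) :
  wave_solution M F1 u1 -> wave_solution M F2 u2 ->
  (forall x t, 0 <= t -> u x t = (u1 x t, u2 x t)) ->
  (forall x t, 0 <= t -> f x t = (F1 x t, F2 x t)) ->
  is_C2_solution M f u.
Proof.
  intros (ux & ut & uxx & uxt & utx & utt & Hu & Eu & Iu)
    (vx & vt & vxx & vxt & vtx & vtt & Hv & Ev & Iv) Hpair Hf.
  destruct Hu, Hv.
  exists (fun x t => (ux x t, vx x t)), (fun x t => (ut x t, vt x t)),
    (fun x t => (uxx x t, vxx x t)), (fun x t => (uxt x t, vxt x t)),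
    (fun x t => (utx x t, vtx x t)), (fun x t => (utt x t, vtt x t)).
  split; [split; [split|]|split].
  - intros x t Ht.
    apply (is_derive_ext (V := C_R_NormedModule) (fun y => (u1 y t, u2 y t))).
    + intros y. symmetry. apply Hpair, Ht.
    + apply is_derive_pair; auto.
  - intros x t Ht. apply is_derive_time_pair with (u1 x) (u2 x); auto.
  - intros x t Ht. apply is_derive_pair; auto.
  - intros x t Ht. apply is_derive_time_pair with (ux x) (vx x); auto.
  - intros x t Ht. apply is_derive_pair; auto.
  - intros x t Ht. apply is_derive_time_pair with (ut x) (vt x); auto.
  - split; [exact (continuous_half_pair u u1 u2 C2_cont0 C2_cont1 Hpair)|].
    repeat split; eapply continuous_half_pair; try reflexivity; assumption.
  - intros x t Ht. rewrite Hpair, Hf by lra. rewrite <- Eu, <- Ev.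
    replace (-2 * t) with (- t + - t) by ring. rewrite exp_plus.
    unfold Cplus, Cminus, Copp, Cmult, Cplus, RtoC; cbn [fst snd]. f_equal; ring.
  - intros x. rewrite Hpair by lra.
    destruct (Iu x) as [-> ->], (Iv x) as [-> ->]. split; reflexivity.
Qed.

Theorem theorem0p3 (M : R) (hM : 0 <= M) (f : R -> R -> C)
    (hf : continuous_with_second_derivatives f)
    (hsupp : forall t, 0 <= t -> compact (support (fun x => f x t))) :
  is_C2_solution M f (source_solution M f).
Proof.
  assert (Lre : is_linear (U := C_R_NormedModule) (V := R_NormedModule) Re) by apply is_linear_fst.
  assert (Lim : is_linear (U := C_R_NormedModule) (V := R_NormedModule) Im) by apply is_linear_snd.
  destruct (reflect_regularity Re Lre f hf) as (gx & gxx & Hg & Hgx & Hgxx & Dg & Dgx).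
  destruct (reflect_regularity Im Lim f hf) as (hx & hxx & Hh & Hhx & Hhxx & Dh & Dhx).
  set (g := reflect Re f) in *. set (h := reflect Im f) in *.
  destruct (profile_kernel_re M) as (P1' & P1'' & HP1).
  destruct (profile_kernel_im M) as (P2' & P2'' & HP2).
  pose proof (wave_solution_duhamel M _ _ _ g gx gxx HP1 Hg Hgx Hgxx Dg Dgx) as Wg1.
  pose proof (wave_solution_duhamel M _ _ _ g gx gxx HP2 Hg Hgx Hgxx Dg Dgx) as Wg2.
  pose proof (wave_solution_duhamel M _ _ _ h hx hxx HP1 Hh Hhx Hhxx Dh Dhx) as Wh1.
  pose proof (wave_solution_duhamel M _ _ _ h hx hxx HP2 Hh Hhx Hhxx Dh Dhx) as Wh2.
  assert (Hf : forall x t, 0 <= t -> f x t = (g x t, h x t)).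
  { intros x t Ht. unfold g, h, reflect. rewrite Rabs_pos_eq by exact Ht.
    apply surjective_pairing. }
  (* The product of [g + i h] with the kernel has real part [g Re - h Im] and imaginary part
     [g Im + h Re], hence the sign on [Wh2]. *)
  refine (is_C2_solution_pair M f _ _ _ _ _
    (wave_solution_plus _ _ _ _ _ Wg1 (wave_solution_opp _ _ _ Wh2))
    (wave_solution_plus _ _ _ _ _ Wg2 Wh1) _ _).
  - intros x t Ht. exact (source_solution_duhamel M f g h Hg Hh Hf x t Ht).
  (* The complex profile equals [1] at [w = 0], so the boundary terms add up to exactly [f]. *)
  - intros x t Ht. rewrite Hf by exact Ht. rewrite kernel_re_0, kernel_im_0. f_equal; ring.
Qed.
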